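(* Fix $\mu>0$, $F>0$, $E\in\mathbb{R}$, let $\gamma$ be the phase of the reference solution, and let $h:\mathbb{N}\to\mathbb{R}$ satisfy $\lim_{j\to\infty}|h(j+1)-h(j)|\,j^{1/4}=0$. Then, as $N\to\infty$, $$\sum_{j=1}^N\frac{e^{i(\mu\gamma(j)+h(j))}}{\gamma'(j)^2}=o(\log N).$$
   Context: The reference solution is $\zeta(x)=(\pi/F^{1/3})^{1/2}\bigl(i\,\mathrm{Ai}(-F^{1/3}(x+E/F))+\mathrm{Bi}(-F^{1/3}(x+E/F))\bigr)$, where $\mathrm{Ai},\mathrm{Bi}$ are the standard Airy functions. It has no real zeros, and $\gamma\in C^\infty(\mathbb{R})$ is the real function with $\zeta(x)=|\zeta(x)|e^{i\gamma(x)}$ and $\gamma(0)\in(-\pi,\pi]$. *)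

(* Defs.v *)
From Stdlib Require Import Reals.
From Coquelicot Require Import Coquelicot.
Open Scope R_scope.

(* Airy functions via their standard improper-integral representations
   (DLMF 9.5.1, 9.5.5):
   Ai(x) = (1/pi) int_0^oo cos(t^3/3 + x t) dt
   Bi(x) = (1/pi) int_0^oo [exp(-t^3/3 + x t) + sin(t^3/3 + x t)] dt
   The improper integrals are limits of RInt over [0,M] as M -> +oo. *)
Definition Ai (x : R) : R :=
  real (Lim (fun M => RInt (fun t => cos (t ^ 3 / 3 + x * t)) 0 M) p_infty) / PI.

Definition Bi (x : R) : R :=
  real (Lim (fun M => RInt (fun t => exp (- (t ^ 3 / 3) + x * t)
                                    + sin (t ^ 3 / 3 + x * t)) 0 M) p_infty) / PI.

(* Reference solution zeta(x) = (pi/F^(1/3))^(1/2) (i Ai(y) + Bi(y)),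
   y = -F^(1/3) (x + E/F), represented by real and imaginary parts. *)
Definition airy_arg (F E x : R) : R := - Rpower F (1/3) * (x + E / F).
Definition zeta_re (F E x : R) : R := sqrt (PI / Rpower F (1/3)) * Bi (airy_arg F E x).
Definition zeta_im (F E x : R) : R := sqrt (PI / Rpower F (1/3)) * Ai (airy_arg F E x).
Definition zeta_abs (F E x : R) : R := sqrt (zeta_re F E x ^ 2 + zeta_im F E x ^ 2).

(* gamma is the (continuous, hence unique) phase: zeta = |zeta| e^{i gamma},
   gamma(0) in (-pi, pi]. *)
Definition is_phase (F E : R) (gamma : R -> R) : Prop :=
  (forall x, continuous gamma x) /\
  (forall x, zeta_re F E x = zeta_abs F E x * cos (gamma x) /\
             zeta_im F E x = zeta_abs F E x * sin (gamma x)) /\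
  - PI < gamma 0 <= PI.

Definition S_re (mu : R) (gamma : R -> R) (h : nat -> R) (N : nat) : R :=
  sum_n_m (fun j => cos (mu * gamma (INR j) + h j) / (Derive gamma (INR j)) ^ 2) 1 N.
Definition S_im (mu : R) (gamma : R -> R) (h : nat -> R) (N : nat) : R :=
  sum_n_m (fun j => sin (mu * gamma (INR j) + h j) / (Derive gamma (INR j)) ^ 2) 1 N.

(* Main.v *)
(* Put w = Bi + i Ai and s = - x.  In the integral for w_s - i sqrt(s) w the amplitude t - sqrt(s)
   cancels the stationary point of the phase t^3/3 - s t, so this quantity is O(s^(-1/2)); an energy
   argument based on w_ss = - s w improves this to O(s^(-3/4)), and constancy of the Wronskian makes
   |w|^2 comparable to s^(-1/2).  Hence gamma'(x) = sqrt(F x) + O(x^(-1/2)).  On blocks of length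
   K j^(1/4), mu gamma + h is then a quadratic polynomial up to o(1), with second difference of
   order j^(-1/2), and Weyl differencing bounds the mean of the exponential over the block by
   O(K^(-1/2)).  Since 1 / gamma'(j)^2 is asymptotic to 1 / (F j), summing over blocks gives
   o(log N). *)
Require Import Defs.
From Stdlib Require Import Reals Lra Lia Psatz Arith.
From Coquelicot Require Import Coquelicot.
Open Scope R_scope.

(** * Logarithmic averages and exponential sums *)

(** The scale j^(1/4) is forced from two sides: it is the longest on which the hypothesis makes [h]
    constant up to o(1), and the shortest on which a second difference of order j^(-1/2) bends the
    phase by a fixed amount. This dictates the precision required of gamma'. Dividing the
    O(s^(-1/2)) bound by |w|, of order s^(-1/4), leaves an error O(s^(-1/4)) in the phase velocity,
    hence O(1) in the phase over a block, which is too much. The improved O(s^(-3/4)) leaves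
    O(s^(-1/2)) in the velocity and O(K j^(-1/4)) in the phase. All information about the Airy
    functions is drawn from their defining integrals. The Airy equation must be obtained although
    these integrals cannot be differentiated twice under the integral sign, and the Wronskian is
    shown positive from the same first-order bounds together with Bi(0) > 0. Since [gamma] is given
    as a continuous function, its differentiability for large arguments is part of what is
    proved. *)

Fixpoint psum (f : nat -> R) (n : nat) : R :=
  match n with O => 0 | S m => psum f m + f m end.

Lemma psum_ext (f g : nat -> R) (n : nat) :
  (forall i, (i < n)%nat -> f i = g i) -> psum f n = psum g n.
Proof.
  induction n as [|n IH]; intros H; simpl; [reflexivity|].
  rewrite IH, H; auto.
Qed.

Lemma psum_add (f : nat -> R) (m n : nat) :
  psum f (m + n) = psum f m + psum (fun i => f (m + i)%nat) n.
Proof.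
  induction n as [|n IH]; simpl.
  - rewrite Nat.add_0_r; ring.
  - rewrite Nat.add_succ_r; simpl; rewrite IH; ring.
Qed.

Lemma psum_plus (f g : nat -> R) (n : nat) :
  psum (fun i => f i + g i) n = psum f n + psum g n.
Proof. induction n as [|n IH]; simpl; [|rewrite IH]; ring. Qed.

Lemma psum_scal (c : R) (f : nat -> R) (n : nat) :
  psum (fun i => c * f i) n = c * psum f n.
Proof. induction n as [|n IH]; simpl; [|rewrite IH]; ring. Qed.

Lemma psum_const (c : R) (n : nat) : psum (fun _ => c) n = INR n * c.
Proof. induction n as [|n IH]; [simpl; ring|]. rewrite S_INR; simpl psum; rewrite IH; ring. Qed.

Lemma psum_le (f g : nat -> R) (n : nat) :
  (forall i, (i < n)%nat -> f i <= g i) -> psum f n <= psum g n.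
Proof.
  induction n as [|n IH]; intros H; simpl; [lra|].
  apply Rplus_le_compat; auto.
Qed.

Lemma psum_Rabs_le (f g : nat -> R) (n : nat) :
  (forall i, (i < n)%nat -> Rabs (f i) <= g i) -> Rabs (psum f n) <= psum g n.
Proof.
  induction n as [|n IH]; intros H; simpl.
  - rewrite Rabs_R0; lra.
  - eapply Rle_trans; [apply Rabs_triang|]; apply Rplus_le_compat; auto.
Qed.

Lemma sum_n_m_psum (f : nat -> R) (N : nat) :
  sum_n_m f 1 N = psum (fun i => f (S i)) N.
Proof.
  induction N as [|N IH].
  - now rewrite sum_n_m_zero by lia.
  - rewrite sum_n_Sm by lia; rewrite IH; reflexivity.
Qed.

(** On a block of length L <= eps a the weight 1/(a+i) is 1/a up to a relative error eps, so the
    block contributes at most 2 eps L/a; as a+i <= 2a there, this is at most 4 eps times the block's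
    share of the harmonic sum. The length depends on the starting point, hence strong induction on
    [n] with [a] free. Only the last, incomplete block is estimated trivially, which costs the final
    [eps] once. *)
Lemma log_sum_of_blocks (u : nat -> R) (eps : R) (A : nat) :
  (forall j, Rabs (u j) <= 1) -> 0 < eps <= 1 -> (1 <= A)%nat ->
  (forall a, (A <= a)%nat -> exists L, (1 <= L)%nat /\ INR L <= eps * INR a /\
     Rabs (psum (fun i => u (a + i)%nat) L) <= eps * INR L) ->
  forall n a, (A <= a)%nat ->
  Rabs (psum (fun i => u (a + i)%nat / INR (a + i)) n) <=
    4 * eps * psum (fun i => / INR (a + i)) n + eps.
Proof.
  intros Hu He HA Hblock n.
  induction n as [n IH] using (well_founded_induction lt_wf); intros a Ha.
  destruct (Hblock a Ha) as (L & HL1 & HLa & HS).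
  assert (Ha1 : 1 <= INR a) by (apply (le_INR 1); lia).
  assert (HL0 : 1 <= INR L) by (apply (le_INR 1); lia).
  assert (Hpos : forall i, INR a <= INR (a + i)) by (intros i; apply le_INR; lia).
  destruct (Nat.lt_ge_cases n L) as [HnL|HnL].
  - assert (H0 : 0 <= psum (fun i => / INR (a + i)) n).
    { replace 0 with (psum (fun _ => 0) n) by (rewrite psum_const; ring).
      apply psum_le; intros i _. specialize (Hpos i).
      apply Rlt_le, Rinv_0_lt_compat; lra. }
    assert (H1 : Rabs (psum (fun i => u (a + i)%nat / INR (a + i)) n) <= INR n * / INR a).
    { rewrite <- psum_const. apply psum_Rabs_le; intros i _. specialize (Hpos i).
      unfold Rdiv; rewrite Rabs_mult, Rabs_inv, (Rabs_right (INR (a + i))) by lra.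
      rewrite <- (Rmult_1_l (/ INR a)).
      apply Rmult_le_compat; auto using Rabs_pos.
      - apply Rlt_le, Rinv_0_lt_compat; lra.
      - apply Rinv_le_contravar; lra. }
    assert (INR n <= INR L) by (apply le_INR; lia).
    assert (INR n * / INR a <= eps).
    { apply Rmult_le_reg_r with (INR a); [lra|].
      rewrite Rmult_assoc, Rinv_l by lra; lra. }
    assert (0 <= 4 * eps * psum (fun i => / INR (a + i)) n) by (apply Rmult_le_pos; lra).
    lra.
  - replace n with (L + (n - L))%nat by lia.
    set (m := (n - L)%nat). rewrite !psum_add.
    assert (IHm := IH m ltac:(unfold m; lia) (a + L)%nat ltac:(lia)).
    rewrite (psum_ext (fun i => u (a + (L + i))%nat / INR (a + (L + i)))
      (fun i => u (a + L + i)%nat / INR (a + L + i)))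
      by (intros; now rewrite Nat.add_assoc).
    rewrite (psum_ext (fun i => / INR (a + (L + i))) (fun i => / INR (a + L + i)))
      by (intros; now rewrite Nat.add_assoc).
    assert (Hb : Rabs (psum (fun i => u (a + i)%nat / INR (a + i)) L)
        <= 4 * eps * psum (fun i => / INR (a + i)) L).
    (* The weight is frozen: 1/(a+i) = 1/a - i/(a(a+i)), and the correction is at most eps/a because
       i <= L <= eps a. *)
    { rewrite (psum_ext _ (fun i => / INR a * u (a + i)%nat
         + - (u (a + i)%nat * INR i / (INR a * INR (a + i))))).
      2:{ intros i _. specialize (Hpos i). rewrite plus_INR in *. field; lra. }
      rewrite psum_plus, psum_scal.
      assert (H1 : Rabs (psum (fun i => - (u (a + i)%nat * INR i / (INR a * INR (a + i)))) L)
         <= INR L * (eps / INR a)).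
      { rewrite <- psum_const. apply psum_Rabs_le; intros i Hi. specialize (Hpos i).
        assert (INR i <= INR L) by (apply le_INR; lia).
        assert (0 <= INR i) by apply pos_INR.
        rewrite Rabs_Ropp. unfold Rdiv.
        rewrite !Rabs_mult, Rabs_inv, Rabs_mult.
        rewrite (Rabs_right (INR i)), (Rabs_right (INR a)), (Rabs_right (INR (a + i))) by lra.
        apply Rle_trans with (1 * (eps * INR a) * / (INR a * INR a)).
        - apply Rmult_le_compat.
          + apply Rmult_le_pos; auto using Rabs_pos.
          + apply Rlt_le, Rinv_0_lt_compat, Rmult_lt_0_compat; lra.
          + apply Rmult_le_compat; auto using Rabs_pos; lra.
          + apply Rinv_le_contravar; [apply Rmult_lt_0_compat; lra|].
            apply Rmult_le_compat_l; lra.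
        - right; field; lra. }
      assert (H2 : INR L * / (2 * INR a) <= psum (fun i => / INR (a + i)) L).
      { rewrite <- psum_const. apply psum_le; intros i Hi. specialize (Hpos i).
        assert (INR i <= INR L) by (apply le_INR; lia).
        apply Rinv_le_contravar; [lra|]. rewrite plus_INR. nra. }
      eapply Rle_trans; [apply Rabs_triang|].
      rewrite Rabs_mult, Rabs_inv, (Rabs_right (INR a)) by lra.
      apply Rle_trans with (4 * eps * (INR L * / (2 * INR a))); [|apply Rmult_le_compat_l; lra].
      apply Rle_trans with (/ INR a * (eps * INR L) + INR L * (eps / INR a)).
      - apply Rplus_le_compat; [|assumption].
        apply Rmult_le_compat_l; [apply Rlt_le, Rinv_0_lt_compat; lra|assumption].
      - right; field; lra. }
    eapply Rle_trans; [apply Rabs_triang|]. lra.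
Qed.

Lemma harmonic_le_ln (n : nat) : (1 <= n)%nat -> psum (fun i => / INR (S i)) n <= 1 + ln (INR n).
Proof.
  induction n as [|n IH]; [lia|]; intros _.
  destruct n as [|n].
  - simpl. rewrite ln_1. lra.
  - specialize (IH ltac:(lia)).
    assert (H1 : 0 < INR (S n)) by (apply lt_0_INR; lia).
    assert (H2 : ln (INR (S n)) = ln (INR (S (S n))) + ln (INR (S n) / INR (S (S n)))).
    { rewrite <- ln_mult; [f_equal|..]; rewrite ?(S_INR (S n)).
      - field; lra.
      - lra.
      - apply Rdiv_lt_0_compat; lra. }
    assert (H3 : ln (INR (S n) / INR (S (S n))) <= - / INR (S (S n))).
    { assert (Hq : 0 < INR (S n) / INR (S (S n)))
        by (apply Rdiv_lt_0_compat; rewrite ?(S_INR (S n)); lra).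

      assert (He := exp_ineq1_le (ln (INR (S n) / INR (S (S n))))).
      rewrite exp_ln in He by exact Hq.
      replace (- / INR (S (S n))) with (INR (S n) / INR (S (S n)) - 1); [lra|].
      rewrite (S_INR (S n)). field; lra. }
    change (psum (fun i => / INR (S i)) (S n) + / INR (S (S n)) <= 1 + ln (INR (S (S n)))).
    lra.
Qed.

(** Writing b_j = c/j + o(1/j), the main part falls under the block estimate, the remainder is a
    small multiple of the harmonic sum, and the harmonic sum is at most 1 + ln N. *)
Lemma weighted_log_sum (u b : nat -> R) (c : R) :
  (forall j, Rabs (u j) <= 1) ->
  (forall eps, 0 < eps -> exists A, forall a, (A <= a)%nat ->
     exists L, (1 <= L)%nat /\ INR L <= eps * INR a /\
     Rabs (psum (fun i => u (a + i)%nat) L) <= eps * INR L) ->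
  (forall eps, 0 < eps -> exists A, forall j, (A <= j)%nat ->
     Rabs (b j - c / INR j) <= eps / INR j) ->
  is_lim_seq (fun N => sum_n_m (fun j => u j * b j) 1 N / ln (INR N)) 0.
Proof.
  intros Hu Hblk Hb. apply is_lim_seq_spec; intros [e He]; simpl.
  (* The tail will be bounded by |c| (4 d H + d) + d H <= c' d (H + 1), with [H] the harmonic sum of
     the tail; [d] makes c' d at most e/2. *)
  set (c' := 4 * Rabs c + 1).
  assert (Hc' : 1 <= c') by (unfold c'; generalize (Rabs_pos c); lra).
  set (d := Rmin 1 (e / (2 * c'))).
  assert (Hd : 0 < d <= 1).
  { unfold d; split; [apply Rmin_glb_lt|apply Rmin_l]; [lra|].
    apply Rdiv_lt_0_compat; lra. }
  assert (Hdc : c' * d <= e / 2).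
  { apply Rle_trans with (c' * (e / (2 * c'))).
    - apply Rmult_le_compat_l; [lra|apply Rmin_r].
    - right; field; lra. }
  destruct (Hblk d ltac:(lra)) as [A1 HA1]. destruct (Hb d ltac:(lra)) as [A2 HA2].
  set (A := S (A1 + A2)).
  set (f := fun j => u j * b j).
  (* Everything independent of N: the initial segment, and 2 c' for the constant in H + 1 <= 2 + ln
     N. It is absorbed by the other half of e ln N. *)
  set (K0 := Rabs (psum (fun i => f (S i)) (A1 + A2)) + 2 * c').
  assert (Hln : is_lim_seq (fun N => ln (INR N)) p_infty).
  { eapply filterlim_comp; [apply is_lim_seq_INR|]. apply is_lim_ln_p. }
  apply is_lim_seq_spec in Hln. destruct (Hln (2 * K0 / e + 1)) as [N0 HN0].
  exists (N0 + A)%nat; intros N HN.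
  specialize (HN0 N ltac:(lia)). simpl in HN0.
  assert (HK0 : 0 < K0) by (unfold K0; generalize (Rabs_pos (psum (fun i => f (S i)) (A1 + A2))); lra).
  assert (Hl0 : 0 < ln (INR N)).
  { assert (0 < 2 * K0 / e) by (apply Rdiv_lt_0_compat; lra). lra. }
  assert (HKe : K0 < e / 2 * ln (INR N)).
  { apply Rle_lt_trans with (e / 2 * (2 * K0 / e)); [right; field; lra|].
    apply Rmult_lt_compat_l; lra. }
  rewrite Rminus_0_r. unfold Rdiv. rewrite Rabs_mult, Rabs_inv, (Rabs_right (ln (INR N))) by lra.
  apply Rmult_lt_reg_r with (ln (INR N)); [lra|].
  rewrite Rmult_assoc, Rinv_l, Rmult_1_r by lra.
  rewrite sum_n_m_psum.
  replace N with ((A1 + A2) + (N - (A1 + A2)))%nat at 1 by (unfold A in HN; lia).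
  set (m := (N - (A1 + A2))%nat). rewrite psum_add.
  set (H := psum (fun i => / INR (A + i)) m).
  assert (HH : H <= 1 + ln (INR N)).
  { eapply Rle_trans; [|apply harmonic_le_ln; unfold A in HN; lia].
    replace N with ((A1 + A2) + m)%nat at 1 by (unfold m, A in *; lia).
    rewrite psum_add. unfold H, A; simpl.
    assert (0 <= psum (fun i => / INR (S i)) (A1 + A2)).
    { replace 0 with (psum (fun _ => 0) (A1 + A2)) by (rewrite psum_const; ring).
      apply psum_le; intros i _. apply Rlt_le, Rinv_0_lt_compat, lt_0_INR; lia. }
    simpl in *. lra. }
  assert (Hlog := log_sum_of_blocks u d A Hu Hd ltac:(unfold A; lia)
    (fun a Ha => HA1 a ltac:(unfold A in Ha; lia)) m A (le_n A)).
  fold H in Hlog.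
  assert (Htail : Rabs (psum (fun i => f (S (A1 + A2 + i))) m) <= c' * d * (H + 1)).
  { rewrite (psum_ext _ (fun i => c * (u (A + i)%nat / INR (A + i))
       + u (A + i)%nat * (b (A + i)%nat - c / INR (A + i)))).
    2:{ intros i _. unfold f, A. simpl Nat.add.
        assert (0 < INR (S (A1 + A2 + i))) by (apply lt_0_INR; lia). field; lra. }
    rewrite psum_plus, psum_scal.
    assert (H2 : Rabs (psum (fun i => u (A + i)%nat * (b (A + i)%nat - c / INR (A + i))) m)
       <= d * H).
    { unfold H. rewrite <- psum_scal. apply psum_Rabs_le; intros i _.
      rewrite Rabs_mult. rewrite <- (Rmult_1_l (d * _)).
      apply Rmult_le_compat; auto using Rabs_pos. apply HA2; unfold A; lia. }
    eapply Rle_trans; [apply Rabs_triang|]. rewrite Rabs_mult.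
    assert (Rabs c * Rabs (psum (fun i => u (A + i)%nat / INR (A + i)) m)
       <= Rabs c * (4 * d * H + d)) by (apply Rmult_le_compat_l; auto using Rabs_pos).
    unfold c'. generalize (Rabs_pos c). intros.
    assert (0 <= 3 * Rabs c * d) by (apply Rmult_le_pos; lra).
    replace ((4 * Rabs c + 1) * d * (H + 1)) with (Rabs c * (4 * d * H + d) + d * H + (3 * Rabs c * d + d)) by ring.
    lra. }
  eapply Rle_lt_trans; [apply Rabs_triang|].
  assert (c' * d * (H + 1) <= c' * d * (2 + ln (INR N))) by (apply Rmult_le_compat_l; [apply Rmult_le_pos|]; lra).
  assert (c' * d * ln (INR N) <= e / 2 * ln (INR N)) by (apply Rmult_le_compat_r; lra).
  assert (c' * d <= c') by (rewrite <- (Rmult_1_r c') at 2; apply Rmult_le_compat_l; lra).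
  unfold K0 in HKe.
  lra.
Qed.

(** * Weyl differencing for quadratic phases *)

Lemma psum_rev (f : nat -> R) (n : nat) : psum f n = psum (fun k => f (n - S k)%nat) n.
Proof.
  induction n as [|n IH]; [reflexivity|].
  assert (H := psum_add (fun k => f (S n - S k)%nat) 1 n).
  change (1 + n)%nat with (S n) in H. rewrite H.
  change (psum f (S n)) with (psum f n + f n). rewrite IH.
  simpl. rewrite Nat.sub_0_r. ring.
Qed.

(** This is |sum of e^(i q(n))|^2 with the off-diagonal pairs grouped by their distance [S k].
    Passing from L to L + 1 adds the pairs (n, L), one for each distance. *)
Lemma sqr_exp_sum (q : nat -> R) (L : nat) :
  psum (fun n => cos (q n)) L ^ 2 + psum (fun n => sin (q n)) L ^ 2 =
  INR L + 2 * psum (fun k => psum (fun n => cos (q (n + S k)%nat - q n)) (L - S k)) L.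
Proof.
  induction L as [|L IH]; [simpl; ring|].
  set (T := fun k r => psum (fun n => cos (q (n + S k)%nat - q n)) r) in *.
  (* The new outer term [k = L] has an empty inner sum. Reversing the row of differences [q L - q n]
     puts the pair with n = L - S k at distance [S k]. *)
  assert (HT : psum (fun k => T k (S L - S k)%nat) (S L)
     = psum (fun k => T k (L - S k)%nat) L + psum (fun n => cos (q L - q n)) L).
  { simpl psum at 1. rewrite Nat.sub_diag. change (T L 0%nat) with 0. rewrite Rplus_0_r.
    rewrite (psum_rev (fun n => cos (q L - q n))), <- psum_plus.
    apply psum_ext; intros k Hk.
    replace (L - k)%nat with (S (L - S k)) by lia. unfold T; simpl psum.
    now replace (L - S k + S k)%nat with L by lia. }
  unfold T in HT. rewrite HT. simpl psum at 1 2. rewrite S_INR.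
  assert (Hx : psum (fun n => cos (q L - q n)) L
    = cos (q L) * psum (fun n => cos (q n)) L + sin (q L) * psum (fun n => sin (q n)) L).
  { rewrite <- !psum_scal, <- psum_plus. apply psum_ext; intros. apply cos_minus. }
  rewrite Hx. generalize (sin2_cos2 (q L)); unfold Rsqr. intros. nra.
Qed.

Lemma half_le_sin (y : R) : 0 <= y <= 1 -> y / 2 <= sin y.
Proof.
  intros [H0 H1].
  destruct (MVT_gen sin 0 y cos) as (c & Hc & He).
  - intros; auto_derive; auto; ring.
  - intros; apply continuity_sin.
  - rewrite Rmin_left, Rmax_right in Hc by lra.
    rewrite sin_0, !Rminus_0_r in He. rewrite He.
    assert (1 / 2 <= cos c).
    { rewrite <- cos_PI3. generalize PI2_3_2; intros.
      apply cos_decr_1; lra. }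
    nra.
Qed.

(** Multiplication by 2 sin(be/2) makes the sum telescope to a difference of two sines; be <= 1
    guarantees 2 sin(be/2) >= be/2. *)
Lemma cos_arith_sum_le (al be : R) (n : nat) :
  0 < be <= 1 -> Rabs (psum (fun i => cos (al + be * INR i)) n) <= 4 / be.
Proof.
  intros Hb.
  assert (Ht : 2 * sin (be / 2) * psum (fun i => cos (al + be * INR i)) n
    = sin (al + be * (INR n - 1 / 2)) - sin (al - be / 2)).
  { induction n as [|n IH].
    - simpl. replace (al + be * (0 - 1 / 2)) with (al - be / 2) by field. ring.
    - simpl psum. rewrite Rmult_plus_distr_l, IH, S_INR.
      replace (al + be * (INR n - 1 / 2)) with ((al + be * INR n) - be / 2) by field.
      replace (al + be * (INR n + 1 - 1 / 2)) with ((al + be * INR n) + be / 2) by field.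
      rewrite sin_plus, sin_minus. ring. }
  assert (Hs := half_le_sin (be / 2) ltac:(lra)).
  set (S := psum _ n) in *.
  assert (Hr : Rabs (2 * sin (be / 2) * S) <= 2).
  { rewrite Ht. generalize (SIN_bound (al + be * (INR n - 1 / 2))) (SIN_bound (al - be / 2)).
    intros. apply Rabs_le; lra. }
  rewrite Rabs_mult, (Rabs_right (2 * _)) in Hr by lra.
  apply Rmult_le_reg_l with be; [lra|].
  replace (be * (4 / be)) with 4 by (field; lra).
  generalize (Rabs_pos S). nra.
Qed.

(** Telescoping: with p^2 = r^2 + 1 one has 2 (p - r) = 2/(p + r) >= 1/p. *)
Lemma sum_inv_sqrt_le (n : nat) : psum (fun k => / sqrt (INR (S k))) n <= 2 * sqrt (INR n).
Proof.
  induction n as [|n IH].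
  - simpl. rewrite sqrt_0; lra.
  - change (psum (fun k => / sqrt (INR (S k))) n + / sqrt (INR (S n)) <= 2 * sqrt (INR (S n))).
    assert (H1 : 0 < sqrt (INR (S n))) by (apply sqrt_lt_R0, lt_0_INR; lia).
    assert (H0 : 0 <= sqrt (INR n)) by apply sqrt_pos.
    assert (E1 := sqrt_sqrt (INR (S n)) (pos_INR _)).
    assert (E0 := sqrt_sqrt (INR n) (pos_INR _)).
    rewrite S_INR in E1 at 3.
    set (p := sqrt (INR (S n))) in *. set (r := sqrt (INR n)) in *.
    assert (Hpr : r <= p) by nra.
    assert (/ p <= 2 * (p - r)); [|lra].
    apply Rmult_le_reg_l with p; [lra|]. rewrite Rinv_r by lra. nra.
Qed.

Lemma Rle_sqrt_mult (x a b : R) : 0 <= x -> x <= a -> x <= b -> x <= sqrt (a * b).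
Proof.
  intros. rewrite <- (sqrt_square x) by assumption.
  apply sqrt_le_1_alt. apply Rmult_le_compat; assumption.
Qed.

(* Weyl differencing; the correlation at lag k is at most min(L, 4/(lam k)),
   estimated here by the geometric mean. *)
Lemma sqr_quadratic_sum_le (c0 c1 lam : R) (L : nat) :
  0 < lam -> lam * INR L <= 1 ->
  psum (fun n => cos (c0 + c1 * INR n + lam * INR n ^ 2 / 2)) L ^ 2
    <= INR L + 8 * INR L / sqrt lam.
Proof.
  intros Hl HL.
  set (q := fun n => c0 + c1 * INR n + lam * INR n ^ 2 / 2).
  assert (Hsq := sqr_exp_sum q L).
  assert (Hs0 := pow2_ge_0 (psum (fun n => sin (q n)) L)).
  (* At lag k the phase difference is affine in n with slope lam k, which [lam * INR L <= 1] keeps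
     in the range of the arithmetic-progression bound. The geometric mean of L and 4/(lam k) is 2
     sqrt(L/lam)/sqrt k, and the sum of 1/sqrt k supplies the factor 2 sqrt L. *)
  assert (H : Rabs (psum (fun k => psum (fun n => cos (q (n + S k)%nat - q n)) (L - S k)) L)
    <= 2 * sqrt (INR L / lam) * (2 * sqrt (INR L))).
  { eapply Rle_trans; [|apply Rmult_le_compat_l; [|apply sum_inv_sqrt_le]].
    2:{ apply Rmult_le_pos; [lra|apply sqrt_pos]. }
    rewrite <- psum_scal. apply psum_Rabs_le; intros k Hk.
    assert (Hk0 : 0 < INR (S k)) by (apply lt_0_INR; lia).
    assert (HkL : INR (S k) <= INR L) by (apply le_INR; lia).
    rewrite (psum_ext _ (fun i => cos ((c1 * INR (S k) + lam * INR (S k) ^ 2 / 2)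
      + (lam * INR (S k)) * INR i))).
    2:{ intros n _. f_equal. unfold q. rewrite plus_INR. field. }
    eapply Rle_trans; [apply (Rle_sqrt_mult _ (INR L) (4 / (lam * INR (S k))))|].
    - apply Rabs_pos.
    - rewrite <- (Rmult_1_r (INR L)).
      eapply Rle_trans; [apply (psum_Rabs_le _ (fun _ => 1))|].
      + intros. apply Rabs_le, COS_bound.
      + rewrite psum_const. apply Rmult_le_compat_r; [lra|]. apply le_INR; lia.
    - apply cos_arith_sum_le. split; [apply Rmult_lt_0_compat; lra|].
      eapply Rle_trans; [|apply HL]. apply Rmult_le_compat_l; lra.
    - right.
      replace (INR L * (4 / (lam * INR (S k)))) with (2 * 2 * (INR L / lam) / INR (S k)) by (field; lra).
      assert (0 <= INR L / lam) by (apply Rmult_le_pos; [apply pos_INR|apply Rlt_le, Rinv_0_lt_compat; lra]).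
      rewrite sqrt_div_alt, sqrt_mult_alt, sqrt_square by lra. reflexivity. }
  replace (2 * sqrt (INR L / lam) * (2 * sqrt (INR L))) with (4 * INR L / sqrt lam) in H.
  2:{ rewrite sqrt_div_alt by lra. rewrite <- (sqrt_sqrt (INR L)) at 1 by apply pos_INR.
      field. apply Rgt_not_eq, sqrt_lt_R0; lra. }
  apply Rabs_le_between in H. unfold q in *. unfold Rdiv in *. lra.
Qed.

(** * Quadratic approximation of the phase on short blocks *)

Lemma Rabs_cos_minus_le (x y : R) : Rabs (cos x - cos y) <= Rabs (x - y).
Proof.
  rewrite <- (Rmult_1_l (Rabs (x - y))).
  apply (bounded_variation cos (fun t => - sin t)). intros t _. split.
  - auto_derive; auto; ring.
  - rewrite Rabs_Ropp. apply Rabs_le, SIN_bound.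
Qed.

(** With p = sqrt a and r = sqrt(a + t) the remainder is exactly -(r - p)^2/(2p), and r - p = t/(r +
    p) <= t/p. *)
Lemma sqrt_taylor1 (a t : R) : 0 < a -> 0 <= t ->
  Rabs (sqrt (a + t) - sqrt a - t / (2 * sqrt a)) <= t ^ 2 / (a * sqrt a).
Proof.
  intros Ha Ht.
  assert (Hp : 0 < sqrt a) by (apply sqrt_lt_R0; lra).
  assert (Hle : sqrt a <= sqrt (a + t)) by (apply sqrt_le_1_alt; lra).
  assert (E0 := sqrt_sqrt a ltac:(lra)). assert (E1 := sqrt_sqrt (a + t) ltac:(lra)).
  set (p := sqrt a) in *. set (r := sqrt (a + t)) in *.
  assert (Et : t = (r - p) * (r + p)) by nra.
  assert (Ed : r - p - t / (2 * p) = - ((r - p) ^ 2 / (2 * p))) by (rewrite Et; field; lra).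
  rewrite Ed, Rabs_Ropp, Rabs_right.
  2:{ apply Rle_ge, Rmult_le_pos; [apply pow2_ge_0|apply Rlt_le, Rinv_0_lt_compat; lra]. }
  rewrite <- E0, Et. apply Rmult_le_reg_r with (2 * (p * p * p)).
  - repeat apply Rmult_lt_0_compat; lra.
  - replace ((r - p) ^ 2 / (2 * p) * (2 * (p * p * p))) with ((r - p) ^ 2 * (p * p)) by (field; lra).
    replace (((r - p) * (r + p)) ^ 2 / (p * p * p) * (2 * (p * p * p)))
      with ((r - p) ^ 2 * (2 * (r + p) ^ 2)) by (field; lra).
    apply Rmult_le_compat_l; [apply pow2_ge_0|nra].
Qed.

(** The mean value theorem is applied to the error [P]: its derivative is the given error of [g]
    plus k times the Taylor remainder of the square root. For n of order a^(1/4) the bound is of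
    order a^(-1/4). *)
Lemma quadratic_approx (f g : R -> R) (k C a : R) (n : nat) :
  0 < a -> 0 <= C -> 0 < k ->
  (forall x, a <= x -> is_derive f x (g x) /\ Rabs (g x - k * sqrt x) <= C / sqrt x) ->
  Rabs (f (a + INR n) - f a - k * sqrt a * INR n - k / (4 * sqrt a) * INR n ^ 2)
    <= INR n * (C / sqrt a + k * INR n ^ 2 / (a * sqrt a)).
Proof.
  intros Ha HC Hk Hf. assert (Hn := pos_INR n).
  assert (Hp : 0 < sqrt a) by (apply sqrt_lt_R0; lra).
  set (P := fun t => f (a + t) - f a - k * sqrt a * t - k / (4 * sqrt a) * t ^ 2).
  set (P' := fun t => g (a + t) - k * sqrt a - k / (2 * sqrt a) * t).
  assert (HP : forall t, 0 <= t -> is_derive P t (P' t)).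
  { intros t Ht. unfold P, P'. destruct (Hf (a + t) ltac:(lra)) as [Hd _].
    auto_derive.
    - now exists (g (a + t)).
    - replace (Derive _ (a + t)) with (g (a + t)) by (symmetry; now apply is_derive_unique). field; lra. }
  destruct (MVT_gen P 0 (INR n) P') as (c & Hc & He).
  - intros x. rewrite Rmin_left by lra. intros; apply HP; lra.
  - intros x. rewrite Rmin_left by lra. intros. apply derivable_continuous_pt.
    eexists. apply is_derive_Reals, HP; lra.
  - rewrite Rmin_left, Rmax_right in Hc by lra.
    change (Rabs (P (INR n)) <= INR n * (C / sqrt a + k * INR n ^ 2 / (a * sqrt a))).
    replace (P (INR n)) with (P' c * INR n).
    2:{ replace (P (INR n)) with (P (INR n) - P 0); [rewrite He; ring|].
        unfold P. rewrite Rplus_0_r. ring. }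
    rewrite Rabs_mult, (Rabs_right (INR n)), Rmult_comm by lra.
    apply Rmult_le_compat_l; [lra|].
    destruct (Hf (a + c) ltac:(lra)) as [_ Hg].
    assert (Ht := sqrt_taylor1 a c Ha ltac:(lra)).
    replace (P' c) with ((g (a + c) - k * sqrt (a + c))
      + k * (sqrt (a + c) - sqrt a - c / (2 * sqrt a))) by (unfold P'; field; lra).
    eapply Rle_trans; [apply Rabs_triang|]. apply Rplus_le_compat.
    + eapply Rle_trans; [apply Hg|]. apply Rmult_le_compat_l; [lra|].
      apply Rinv_le_contravar; [lra|]. apply sqrt_le_1_alt; lra.
    + rewrite Rabs_mult, (Rabs_right k) by lra. unfold Rdiv. rewrite Rmult_assoc.
      apply Rmult_le_compat_l; [lra|]. eapply Rle_trans; [apply Ht|].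
      apply Rmult_le_compat_r.
      * apply Rlt_le, Rinv_0_lt_compat, Rmult_lt_0_compat; lra.
      * simpl; nra.
Qed.

(** Written as two square roots so that monotonicity of [sqrt] applies directly; [Rpower_quarter]
    matches it with the exponent in the hypothesis on [h]. *)
Definition root4 (x : R) : R := sqrt (sqrt x).

Lemma root4_pow4 (x : R) : 0 <= x -> root4 x ^ 4 = x.
Proof.
  intros Hx. unfold root4. replace (sqrt (sqrt x) ^ 4) with ((sqrt (sqrt x) * sqrt (sqrt x)) * (sqrt (sqrt x) * sqrt (sqrt x))) by ring.
  rewrite sqrt_sqrt by apply sqrt_pos. now apply sqrt_sqrt.
Qed.

Lemma Rpower_quarter (x : R) : 0 < x -> Rpower x (1 / 4) = root4 x.
Proof.
  intros Hx. replace (1 / 4) with (/ 2 * / 2) by lra.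
  rewrite <- Rpower_mult, (Rpower_sqrt x) by assumption.
  apply Rpower_sqrt. now apply sqrt_lt_R0.
Qed.

Lemma increments_le (h : nat -> R) (d : R) (a : nat) :
  (forall j, (a <= j)%nat -> Rabs (h (S j) - h j) <= d) ->
  forall n, Rabs (h (a + n)%nat - h a) <= INR n * d.
Proof.
  intros Hd; induction n as [|n IH].
  - rewrite Nat.add_0_r, Rminus_diag, Rabs_R0; simpl; lra.
  - rewrite Nat.add_succ_r, S_INR.
    replace (h (S (a + n)) - h a) with ((h (S (a + n)) - h (a + n)%nat) + (h (a + n)%nat - h a)) by ring.
    specialize (Hd (a + n)%nat ltac:(lia)).
    eapply Rle_trans; [apply Rabs_triang|]. lra.
Qed.

(* Blocks of length about K a^(1/4): on such a block the phase is, up to o(1), a quadratic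
   polynomial whose leading coefficient has size a^(-1/2). *)
Lemma small_block_means (mu k C X0 : R) (f g : R -> R) (h : nat -> R) :
  0 < mu -> 0 < k -> 0 <= C ->
  (forall x, X0 <= x -> is_derive f x (g x) /\ Rabs (g x - k * sqrt x) <= C / sqrt x) ->
  is_lim_seq (fun j => Rabs (h (S j) - h j) * Rpower (INR j) (1/4)) 0 ->
  forall eps, 0 < eps -> exists A, forall a, (A <= a)%nat ->
    exists L, (1 <= L)%nat /\ INR L <= eps * INR a /\
    Rabs (psum (fun i => cos (mu * f (INR (a + i)) + h (a + i)%nat)) L) <= eps * INR L.
Proof.
  intros Hmu Hk HC Hf Hh eps Heps.
  (* With Q = a^(1/4) and lam = mu k/(2 Q^2) this gives sqrt lam = m/Q. The Weyl bound divided by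
     L^2 is then at most (1 + 8/m)/K, and [K] is chosen to make this at most (eps/2)^2. *)
  set (m := sqrt (mu * k / 2)).
  assert (Hmk : 0 < mu * k) by (apply Rmult_lt_0_compat; lra).
  assert (Hm : 0 < m) by (apply sqrt_lt_R0; lra).
  set (K := (1 + 8 / m) * (4 / eps ^ 2) + 1).
  assert (H8m : 0 < 8 / m) by (apply Rdiv_lt_0_compat; lra).
  assert (He2 : 0 < 4 / eps ^ 2) by (apply Rdiv_lt_0_compat; [lra|apply pow_lt; lra]).
  assert (HK : 1 < K) by (unfold K; generalize (Rmult_lt_0_compat _ _ (Rplus_lt_0_compat _ _ Rlt_0_1 H8m) He2); lra).
  assert (HK0 : (1 + 8 / m) * (4 / eps ^ 2) <= K) by (unfold K; lra).
  (* At most 2 K Q increments of [h], each at most d/Q, add up to eps/4. *)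
  set (d := eps / (8 * K)).
  assert (Hd : 0 < d) by (apply Rdiv_lt_0_compat; lra).
  apply is_lim_seq_spec in Hh. destruct (Hh (mkposreal d Hd)) as [A1 HA1]. simpl in HA1.
  (* For n <= 2 K Q the bound of [quadratic_approx], multiplied by mu, is at most V/Q. *)
  set (V := mu * (2 * K * C + 8 * k * K ^ 3)).
  assert (HV : 0 <= V).
  { unfold V. apply Rmult_le_pos; [lra|]. apply Rplus_le_le_0_compat.
    - repeat apply Rmult_le_pos; lra.
    - apply Rmult_le_pos; [lra|apply pow_le; lra]. }
  (* A lower bound for Q; its summands ensure in turn Q >= 1, a >= X0, L <= eps a, lam L <= 1 and
     V/Q <= eps/4. *)
  set (B := 1 + Rabs X0 + 2 * K / eps + mu * k * K + 4 * V / eps).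
  assert (P1 : 0 < 2 * K / eps) by (apply Rdiv_lt_0_compat; lra).
  assert (P2 : 0 < mu * k * K) by (apply Rmult_lt_0_compat; lra).
  assert (P3 : 0 <= 4 * V / eps) by (apply Rmult_le_pos; [lra|apply Rlt_le, Rinv_0_lt_compat; lra]).
  assert (P4 := Rabs_pos X0).
  destruct (nfloor_ex (B ^ 4)) as [A2 HA2]; [apply pow_le; unfold B; lra|].
  exists (A1 + S A2)%nat; intros a Ha.
  assert (Ha0 : B ^ 4 < INR a).
  { destruct HA2 as [_ HA2]. eapply Rlt_le_trans; [apply HA2|]. rewrite <- S_INR. apply le_INR; lia. }
  assert (HB1 : 1 <= B) by (unfold B; lra).
  assert (Hap : 0 < INR a) by (eapply Rlt_trans; [apply pow_lt with (n := 4%nat)|apply Ha0]; lra).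
  set (Q := root4 (INR a)).
  assert (HQ4 : Q ^ 4 = INR a) by (apply root4_pow4; lra).
  assert (HQB : B <= Q).
  { unfold Q, root4. rewrite <- (sqrt_square B) by lra. apply sqrt_le_1_alt.
    rewrite <- (sqrt_square (B * B)) by nra. apply sqrt_le_1_alt.
    replace (B * B * (B * B)) with (B ^ 4) by ring. lra. }
  assert (HQ2 : sqrt (INR a) = Q ^ 2).
  { unfold Q, root4. rewrite pow2_sqrt; [reflexivity|apply sqrt_pos]. }
  assert (HQ1 : 1 <= Q) by lra.
  assert (HQ3 : 1 <= Q ^ 3) by (apply pow_R1_Rle; lra).
  assert (HQa : Q <= INR a) by (rewrite <- HQ4; replace (Q ^ 4) with (Q * Q ^ 3) by ring; nra).
  assert (HKQ : 0 <= K * Q) by nra.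
  destruct (nfloor_ex (K * Q) HKQ) as [n0 Hn0].
  (* One more than the floor, so that L >= K Q; L <= 2 K Q follows from K Q >= 1. *)
  set (L := S n0).
  assert (HL : K * Q <= INR L <= 2 * K * Q) by (unfold L; rewrite S_INR; nra).
  assert (HLp : 0 < INR L) by nra.
  exists L. split; [unfold L; lia|]. split.
  { apply Rle_trans with (2 * K * Q); [lra|].
    assert (2 * K <= eps * Q).
    { apply Rle_trans with (eps * (2 * K / eps)); [right; field; lra|].
      apply Rmult_le_compat_l; unfold B in HQB; lra. }
    apply Rle_trans with (eps * Q * Q); [nra|].
    rewrite <- HQ4. replace (Q ^ 4) with (Q * Q * (Q * Q)) by ring.
    assert (1 <= Q * Q) by nra. assert (0 <= eps * (Q * Q)) by nra. nra. }
  set (lam := mu * k / (2 * Q ^ 2)).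
  assert (HQ2p : 0 < Q ^ 2) by (apply pow_lt; lra).
  assert (Hlam : 0 < lam) by (apply Rdiv_lt_0_compat; lra).
  set (c0 := mu * f (INR a) + h a). set (c1 := mu * k * Q ^ 2).
  set (T := psum (fun n => cos (c0 + c1 * INR n + lam * INR n ^ 2 / 2)) L).
  assert (HT2 : T ^ 2 <= INR L + 8 * INR L / sqrt lam).
  { apply sqr_quadratic_sum_le; [assumption|].
    apply Rle_trans with (lam * (2 * K * Q)).
    - apply Rmult_le_compat_l; lra.
    - replace (lam * (2 * K * Q)) with (mu * k * K / Q) by (unfold lam; field; lra).
      apply Rmult_le_reg_r with Q; [lra|]. unfold Rdiv. rewrite Rmult_assoc, Rinv_l by lra.
      unfold B in HQB; lra. }
  assert (HT : Rabs T <= eps / 2 * INR L).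
  { replace (sqrt lam) with (m / Q) in HT2.
    2:{ unfold lam, m. replace (mu * k / (2 * Q ^ 2)) with (mu * k / 2 / Q ^ 2) by (field; lra).
        rewrite (sqrt_div_alt _ (Q ^ 2)) by lra. rewrite sqrt_pow2 by lra. reflexivity. }
    assert (H1 : INR L + 8 * INR L / (m / Q) <= (eps / 2 * INR L) ^ 2).
    { replace (8 * INR L / (m / Q)) with (8 / m * (Q * INR L)) by (field; lra).
      apply Rle_trans with ((1 + 8 / m) * (Q * INR L)); [nra|].
      replace ((eps / 2 * INR L) ^ 2) with (eps ^ 2 / 4 * INR L * INR L) by field.
      rewrite <- Rmult_assoc. apply Rmult_le_compat_r; [lra|].
      apply Rle_trans with (eps ^ 2 / 4 * (K * Q)).
      - rewrite <- Rmult_assoc. apply Rmult_le_compat_r; [lra|].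
        apply Rle_trans with (eps ^ 2 / 4 * ((1 + 8 / m) * (4 / eps ^ 2))).
        + right; field; lra.
        + apply Rmult_le_compat_l; [|lra]. assert (0 < eps ^ 2) by (apply pow_lt; lra). lra.
      - apply Rmult_le_compat_l; [|lra]. assert (0 < eps ^ 2) by (apply pow_lt; lra). lra. }
    rewrite <- (Rabs_right (eps / 2 * INR L)) by (apply Rle_ge, Rmult_le_pos; lra).
    apply Rsqr_le_abs_0. unfold Rsqr. lra. }
  assert (Herr : forall n, (n < L)%nat ->
    Rabs (cos (mu * f (INR (a + n)) + h (a + n)%nat) - cos (c0 + c1 * INR n + lam * INR n ^ 2 / 2))
      <= eps / 2).
  { intros n Hn. eapply Rle_trans; [apply Rabs_cos_minus_le|].
    assert (HnL : 0 <= INR n <= INR L) by (split; [apply pos_INR|apply le_INR; lia]).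
    assert (Hh' : Rabs (h (a + n)%nat - h a) <= eps / 4).
    { apply Rle_trans with (INR n * (d / Q)).
      - apply increments_le. intros j Hj.
        specialize (HA1 j ltac:(lia)).
        assert (INR a <= INR j) by (apply le_INR; lia).
        rewrite Rpower_quarter, Rminus_0_r, Rabs_mult, Rabs_Rabsolu in HA1 by lra.
        assert (HQj : Q <= root4 (INR j)) by (unfold Q, root4; do 2 apply sqrt_le_1_alt; lra).
        rewrite (Rabs_right (root4 _)) in HA1 by lra.
        apply Rmult_le_reg_r with Q; [lra|].
        replace (d / Q * Q) with d by (field; lra).
        generalize (Rabs_pos (h (S j) - h j)). nra.
      - apply Rle_trans with (2 * K * Q * (d / Q)).
        + apply Rmult_le_compat_r; [|lra]. apply Rlt_le, Rdiv_lt_0_compat; lra.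
        + right. unfold d. field. lra. }
    assert (Hfa := quadratic_approx f g k C (INR a) n Hap HC Hk
      (fun x Hx => Hf x ltac:(unfold B in HQB; generalize (Rle_abs X0); lra))).
    rewrite HQ2 in Hfa.
    assert (Hf' : Rabs (f (INR a + INR n) - f (INR a) - k * Q ^ 2 * INR n - k / (4 * Q ^ 2) * INR n ^ 2)
       <= V / mu / Q).
    { eapply Rle_trans; [apply Hfa|].
      apply Rle_trans with (2 * K * Q * (C / Q ^ 2 + k * (2 * K * Q) ^ 2 / (INR a * Q ^ 2))).
      - apply Rmult_le_compat; try lra.
        + apply Rplus_le_le_0_compat; apply Rmult_le_pos; try lra.
          * apply Rlt_le, Rinv_0_lt_compat; lra.
          * apply Rmult_le_pos; [lra|apply pow2_ge_0].
          * apply Rlt_le, Rinv_0_lt_compat, Rmult_lt_0_compat; lra.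
        + apply Rplus_le_compat_l. apply Rmult_le_compat_r.
          * apply Rlt_le, Rinv_0_lt_compat, Rmult_lt_0_compat; lra.
          * apply Rmult_le_compat_l; [lra|]. apply pow_incr; lra.
      - rewrite <- HQ4. unfold V.
        replace (2 * K * Q * (C / Q ^ 2 + k * (2 * K * Q) ^ 2 / (Q ^ 4 * Q ^ 2)))
          with ((2 * K * C + 8 * k * K ^ 3 * / Q ^ 2) / Q) by (field; lra).
        replace (mu * (2 * K * C + 8 * k * K ^ 3) / mu / Q) with ((2 * K * C + 8 * k * K ^ 3) / Q) by (field; lra).
        apply Rmult_le_compat_r; [apply Rlt_le, Rinv_0_lt_compat; lra|].
        apply Rplus_le_compat_l. rewrite <- (Rmult_1_r (8 * k * K ^ 3)) at 2.
        apply Rmult_le_compat_l.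
        + apply Rmult_le_pos; [lra|apply pow_le; lra].
        + rewrite <- Rinv_1. apply Rinv_le_contravar; [lra|]. apply pow_R1_Rle; lra. }
    rewrite plus_INR.
    replace (mu * f (INR a + INR n) + h (a + n)%nat - (c0 + c1 * INR n + lam * INR n ^ 2 / 2))
      with (mu * (f (INR a + INR n) - f (INR a) - k * Q ^ 2 * INR n - k / (4 * Q ^ 2) * INR n ^ 2)
       + (h (a + n)%nat - h a)) by (unfold c0, c1, lam; field; lra).
    eapply Rle_trans; [apply Rabs_triang|]. rewrite Rabs_mult, (Rabs_right mu) by lra.
    assert (mu * (V / mu / Q) <= eps / 4).
    { replace (mu * (V / mu / Q)) with (V / Q) by (field; lra).
      apply Rmult_le_reg_r with Q; [lra|]. unfold Rdiv at 1. rewrite Rmult_assoc, Rinv_l by lra.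
      apply Rle_trans with (eps / 4 * (4 * V / eps)); [right; field; lra|].
      apply Rmult_le_compat_l; unfold B in HQB; lra. }
    assert (mu * Rabs (f (INR a + INR n) - f (INR a) - k * Q ^ 2 * INR n - k / (4 * Q ^ 2) * INR n ^ 2)
       <= mu * (V / mu / Q)) by (apply Rmult_le_compat_l; lra).
    lra. }
  rewrite (psum_ext _ (fun n => cos (c0 + c1 * INR n + lam * INR n ^ 2 / 2)
    + (cos (mu * f (INR (a + n)) + h (a + n)%nat) - cos (c0 + c1 * INR n + lam * INR n ^ 2 / 2))))
    by (intros; ring).
  rewrite psum_plus. eapply Rle_trans; [apply Rabs_triang|]. fold T.
  apply psum_Rabs_le in Herr. rewrite psum_const in Herr. lra.
Qed.

(** * Airy integrals *)

Lemma ex_lim_of_cauchy (f : R -> R) :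
  (forall eps, 0 < eps -> exists M0, forall M1 M2, M0 <= M1 -> M1 <= M2 -> Rabs (f M2 - f M1) <= eps) ->
  exists l : R, is_lim f p_infty l.
Proof.
  intros Hc.
  destruct (proj1 (filterlim_locally_cauchy (U := R_CompleteSpace) (F := Rbar_locally' p_infty) f)) as [l Hl].
  - intros [e He]. destruct (Hc (e / 4) ltac:(lra)) as [M0 HM0].
    exists (fun M => M0 < M). split; [now exists M0|].
    intros M1 M2 H1 H2. simpl. unfold ball; simpl; unfold AbsRing_ball, abs, minus, plus, opp; simpl.
    destruct (Rle_dec M1 M2) as [H|H].
    + specialize (HM0 M1 M2 ltac:(lra) H). unfold Rminus in HM0. lra.
    + specialize (HM0 M2 M1 ltac:(lra) ltac:(lra)). rewrite Rabs_minus_sym in HM0. unfold Rminus in HM0. lra.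
  - now exists l.
Qed.

Lemma is_lim_Rabs_le (f : R -> R) (l e M0 : R) :
  is_lim f p_infty l -> (forall M, M0 <= M -> Rabs (f M) <= e) -> Rabs l <= e.
Proof.
  intros Hl He.
  apply (is_lim_le_loc (fun M => Rabs (f M)) (fun _ => e) p_infty (Rabs l) e).
  - exists M0. intros; apply He; lra.
  - now apply (is_lim_Rabs f p_infty l).
  - apply is_lim_const.
Qed.

Lemma is_lim_dist_le (f : R -> R) (l c e M0 : R) :
  is_lim f p_infty l -> (forall M, M0 <= M -> Rabs (f M - c) <= e) -> Rabs (l - c) <= e.
Proof.
  intros Hl He. apply (is_lim_Rabs_le (fun M => f M - c) (l - c) e M0); [|assumption].
  apply (is_lim_minus f (fun _ => c) p_infty l c); [assumption|apply is_lim_const|reflexivity].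
Qed.

(** The mean value inequality for [f M y - G x * y] is uniform in M and therefore survives the
    limit. It rests on |g M y - G x| <= 4 e near x, obtained by passing through [G y], [g M1 y] and
    [g M1 x] for one fixed [M1], so that continuity is used only for [g M1]. *)
Lemma is_derive_lim (f g : R -> R -> R) (F G : R -> R) (x X : R) :
  Rabs x < X ->
  (forall M y, 1 <= M -> is_derive (f M) y (g M y)) ->
  (forall M, 1 <= M -> continuous (g M) x) ->
  (forall y, is_lim (fun M => f M y) p_infty (F y)) ->
  (forall eps, 0 < eps -> exists M0, forall M y, M0 <= M -> Rabs y <= X -> Rabs (g M y - G y) <= eps) ->
  is_derive F x (G x).
Proof.
  intros Hx Hd Hc Hl Hu. apply is_derive_Reals. intros eps Heps.
  (* The difference quotient will be within 4 e = eps/2 of [G x], which leaves the strict inequality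
     that the definition demands. *)
  set (e := eps / 8). assert (He : 0 < e) by (unfold e; lra).
  destruct (Hu e He) as [M0 HM0]. set (M1 := Rmax M0 1).
  assert (HM1 : M0 <= M1 /\ 1 <= M1) by (split; [apply Rmax_l|apply Rmax_r]).
  assert (Hc1 : continuity_pt (g M1) x) by (apply continuity_pt_filterlim, Hc; lra).
  destruct (proj1 (continuity_pt_locally (g M1) x) Hc1 (mkposreal e He)) as [[d Hd0] Hd1]. simpl in Hd1.
  assert (Hmin : 0 < Rmin d (X - Rabs x)) by (apply Rmin_glb_lt; lra).
  exists (mkposreal _ Hmin). intros h Hh0 Hh. simpl in Hh.
  assert (Hhd : Rabs h < d) by (eapply Rlt_le_trans; [apply Hh|apply Rmin_l]).
  assert (HhX : Rabs h < X - Rabs x) by (eapply Rlt_le_trans; [apply Hh|apply Rmin_r]).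
  assert (Hb : Rabs (F (x + h) - F x - G x * h) <= 4 * e * Rabs h).
  { apply (is_lim_Rabs_le (fun M => f M (x + h) - f M x - G x * h) _ _ M1).
    - apply (is_lim_minus _ _ p_infty (F (x + h) - F x) (G x * h)); [|apply is_lim_const|reflexivity].
      apply (is_lim_minus _ _ p_infty (F (x + h)) (F x)); [apply Hl|apply Hl|reflexivity].
    - intros M HM.
      replace (f M (x + h) - f M x - G x * h)
        with ((f M (x + h) - G x * (x + h)) - (f M x - G x * x)) by ring.
      replace (Rabs h) with (Rabs (x + h - x)) by (f_equal; ring).
      apply (bounded_variation (fun y => f M y - G x * y) (fun y => g M y - G x)).
      intros t Ht. replace (x + h - x) with h in Ht by ring. split.
      + apply (is_derive_minus (f M) (fun y => G x * y)); [apply Hd; lra|].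
        auto_derive; auto; ring.
      + assert (HtX : Rabs t <= X).
        { replace t with ((t - x) + x) by ring. eapply Rle_trans; [apply Rabs_triang|]. lra. }
        specialize (Hd1 t). unfold ball in Hd1; simpl in Hd1.
        unfold AbsRing_ball, abs, minus, plus, opp in Hd1; simpl in Hd1.
        specialize (Hd1 ltac:(unfold Rminus in Ht; lra)).
        assert (A1 := HM0 M t ltac:(lra) HtX). assert (A2 := HM0 M1 t ltac:(lra) HtX).
        assert (A3 := HM0 M1 x ltac:(lra) ltac:(lra)).
        apply Rabs_le_between in A1. apply Rabs_le_between in A2. apply Rabs_le_between in A3.
        apply Rabs_def2 in Hd1. apply Rabs_le. lra. }
  replace ((F (x + h) - F x) / h - G x) with ((F (x + h) - F x - G x * h) / h) by (field; assumption).
  unfold Rdiv. rewrite Rabs_mult, Rabs_inv.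
  apply Rle_lt_trans with (4 * e * Rabs h * / Rabs h).
  - apply Rmult_le_compat_r; [|assumption]. apply Rlt_le, Rinv_0_lt_compat, Rabs_pos_lt; assumption.
  - rewrite Rmult_assoc, Rinv_r by (apply Rgt_not_eq, Rabs_pos_lt; assumption). unfold e; lra.
Qed.

Lemma continuous_section (k : R -> R -> R) (x t : R) : continuity_2d_pt k x t -> continuous (k x) t.
Proof.
  intros H. apply continuity_pt_filterlim, continuity_pt_locally. intros eps.
  destruct (H eps) as [d Hd]. exists d. intros y Hy. apply Hd; [|exact Hy].
  rewrite Rminus_diag, Rabs_R0. apply cond_pos.
Qed.

Lemma is_derive_RInt_param_kernel (k k' : R -> R -> R) (a b x : R) :
  (forall x t, is_derive (fun z => k z t) x (k' x t)) ->
  (forall x t, continuity_2d_pt k x t) -> (forall x t, continuity_2d_pt k' x t) ->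
  is_derive (fun z => RInt (k z) a b) x (RInt (k' x) a b).
Proof.
  intros Hd Hk Hk'.
  rewrite (RInt_ext (k' x) (fun t => Derive (fun z => k z t) x)).
  2:{ intros t _. symmetry. apply is_derive_unique, Hd. }
  apply (is_derive_RInt_param k).
  - apply filter_forall. intros y t _. eexists; apply Hd.
  - intros t _. apply continuity_2d_pt_ext with (2 := Hk' x t).
    intros y s. symmetry. apply is_derive_unique, Hd.
  - apply filter_forall. intros y. apply (@ex_RInt_continuous R_CompleteNormedModule).
    intros; now apply continuous_section.
Qed.

(* The second x-derivative k2 of an oscillatory Airy kernel is not integrable on [0, oo), so the
   equation F'' = x F is obtained weakly: the boundary term b(x, M) of
   k2 - x k0 = db/dt oscillates, but its antiderivative B(x, M) in x tends to 0. *)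
Theorem airy_equation_of_kernel (k0 k1 k2 b B : R -> R -> R) :
  (forall x t, is_derive (fun z => k0 z t) x (k1 x t)) ->
  (forall x t, is_derive (fun z => k1 z t) x (k2 x t)) ->
  (forall x t, continuity_2d_pt k0 x t) ->
  (forall x t, continuity_2d_pt k1 x t) ->
  (forall x t, continuity_2d_pt k2 x t) ->
  (forall x t, is_derive (b x) t (k2 x t - x * k0 x t)) ->
  (forall x, b x 0 = 0) ->
  (forall x t, 1 <= t -> is_derive (fun z => B z t) x (b x t)) ->
  (forall X eps, 0 < X -> 0 < eps -> exists M0, forall M1 M2 x, M0 <= M1 -> M1 <= M2 -> Rabs x <= X ->
     Rabs (RInt (k0 x) M1 M2) <= eps /\ Rabs (RInt (k1 x) M1 M2) <= eps /\ Rabs (B x M1) <= eps) ->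
  exists F F1 : R -> R, forall x,
    is_lim (fun M => RInt (k0 x) 0 M) p_infty (F x) /\
    is_lim (fun M => RInt (k1 x) 0 M) p_infty (F1 x) /\
    is_derive F x (F1 x) /\ is_derive F1 x (x * F x).
Proof.
  intros D0 D1 C0 C1 C2 Db b0 DB Ht.
  assert (E0 : forall x u v, ex_RInt (k0 x) u v).
  { intros. apply (@ex_RInt_continuous R_CompleteNormedModule). intros; now apply continuous_section. }
  assert (E1 : forall x u v, ex_RInt (k1 x) u v).
  { intros. apply (@ex_RInt_continuous R_CompleteNormedModule). intros; now apply continuous_section. }
  assert (Diff : forall (k : R -> R -> R) x M1 M2, (forall u v, ex_RInt (k x) u v) ->
    RInt (k x) 0 M2 - RInt (k x) 0 M1 = RInt (k x) M1 M2).
  { intros k x M1 M2 E. rewrite <- (RInt_Chasles (k x) 0 M1 M2) by apply E.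
    unfold plus; simpl. ring. }
  assert (HX : forall x, 0 < Rabs x + 1) by (intros x; generalize (Rabs_pos x); lra).
  assert (Hxx : forall x, Rabs x <= Rabs x + 1) by (intros; lra).
  assert (L0 : forall x, exists l : R, is_lim (fun M => RInt (k0 x) 0 M) p_infty l).
  { intros x. apply ex_lim_of_cauchy. intros eps He.
    destruct (Ht (Rabs x + 1) eps (HX x) He) as [M0 HM0]. exists M0. intros M1 M2 H1 H2.
    rewrite Diff by apply E0. apply (HM0 M1 M2 x H1 H2 (Hxx x)). }
  assert (L1 : forall x, exists l : R, is_lim (fun M => RInt (k1 x) 0 M) p_infty l).
  { intros x. apply ex_lim_of_cauchy. intros eps He.
    destruct (Ht (Rabs x + 1) eps (HX x) He) as [M0 HM0]. exists M0. intros M1 M2 H1 H2.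
    rewrite Diff by apply E1. apply (HM0 M1 M2 x H1 H2 (Hxx x)). }
  set (F := fun x => real (Lim (fun M => RInt (k0 x) 0 M) p_infty)).
  set (F1 := fun x => real (Lim (fun M => RInt (k1 x) 0 M) p_infty)).
  assert (HF : forall x, is_lim (fun M => RInt (k0 x) 0 M) p_infty (F x)).
  { intros x. destruct (L0 x) as [l Hl]. unfold F. now rewrite (is_lim_unique _ _ _ Hl). }
  assert (HF1 : forall x, is_lim (fun M => RInt (k1 x) 0 M) p_infty (F1 x)).
  { intros x. destruct (L1 x) as [l Hl]. unfold F1. now rewrite (is_lim_unique _ _ _ Hl). }
  assert (U : forall X eps, 0 < X -> 0 < eps -> exists M0, forall M x, M0 <= M -> Rabs x <= X ->
    Rabs (RInt (k0 x) 0 M - F x) <= eps /\ Rabs (RInt (k1 x) 0 M - F1 x) <= eps /\ Rabs (B x M) <= eps).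
  { intros X eps HX0 He. destruct (Ht X eps HX0 He) as [M0 HM0]. exists M0.
    (* The degenerate interval from M to M yields the bound on [B x M]. *)
    intros M x HM Hx. split; [|split; [|apply (HM0 M M x HM (Rle_refl M) Hx)]].
    - rewrite Rabs_minus_sym. apply (is_lim_dist_le _ _ _ _ M (HF x)). intros M2 H2.
      rewrite Diff by apply E0. apply (HM0 M M2 x HM H2 Hx).
    - rewrite Rabs_minus_sym. apply (is_lim_dist_le _ _ _ _ M (HF1 x)). intros M2 H2.
      rewrite Diff by apply E1. apply (HM0 M M2 x HM H2 Hx). }
  exists F, F1. intros x. split; [apply HF|]. split; [apply HF1|]. split.
  - apply (is_derive_lim (fun M z => RInt (k0 z) 0 M) (fun M z => RInt (k1 z) 0 M)) with (X := Rabs x + 1).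
    + lra.
    + intros. now apply is_derive_RInt_param_kernel.
    + intros. apply (ex_derive_continuous (fun z => RInt (k1 z) 0 M)).
      eexists. now apply is_derive_RInt_param_kernel.
    + apply HF.
    + intros eps He. destruct (U (Rabs x + 1) eps (HX x) He) as [M0 HM0]. exists M0.
      intros M y HM Hy. apply (HM0 M y HM Hy).
  (* Subtracting [B z M] turns the derivative [RInt (k2 z) 0 M] into [z * RInt (k0 z) 0 M], because
     [b z 0 = 0]. The latter converges uniformly on bounded sets, while the limit of the
     approximants is still [F1]. *)
  - apply (is_derive_lim (fun M z => RInt (k1 z) 0 M - B z M) (fun M z => z * RInt (k0 z) 0 M)
      F1 (fun z => z * F z)) with (X := Rabs x + 1).
    + lra.
    + intros M y HM.
      replace (y * RInt (k0 y) 0 M) with (RInt (k2 y) 0 M - b y M).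
      * apply (is_derive_minus (fun z => RInt (k1 z) 0 M) (fun z => B z M)).
        -- now apply is_derive_RInt_param_kernel.
        -- now apply DB.
      * assert (HI : is_RInt (fun t => k2 y t - y * k0 y t) 0 M (b y M - b y 0)).
        { apply (is_RInt_derive (b y)).
          - intros; apply Db.
          - intros t _. apply (continuous_minus (k2 y) (fun t => y * k0 y t)).
            + now apply continuous_section.
            + apply (continuous_mult (fun _ => y) (k0 y)); [apply continuous_const|].
              now apply continuous_section. }
        assert (E2 : ex_RInt (k2 y) 0 M).
        { apply (@ex_RInt_continuous R_CompleteNormedModule). intros; now apply continuous_section. }
        assert (HJ : is_RInt (fun t => k2 y t - y * k0 y t) 0 M (RInt (k2 y) 0 M - y * RInt (k0 y) 0 M)).
        { apply (is_RInt_minus (k2 y) (fun t => y * k0 y t)).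
          - exact (@RInt_correct R_CompleteNormedModule _ _ _ E2).
          - apply (is_RInt_scal (k0 y) 0 M y). exact (@RInt_correct R_CompleteNormedModule _ _ _ (E0 y 0 M)). }
        assert (Heq := eq_trans (eq_sym (is_RInt_unique _ _ _ _ HI)) (is_RInt_unique _ _ _ _ HJ)).
        rewrite b0 in Heq. lra.
    + intros M HM. apply (continuous_mult (fun z => z) (fun z => RInt (k0 z) 0 M)); [apply continuous_id|].
      apply (ex_derive_continuous (fun z => RInt (k0 z) 0 M)).
      eexists. now apply is_derive_RInt_param_kernel.
    + intros y. replace (F1 y) with (F1 y - 0) by ring.
      apply (is_lim_minus _ _ p_infty (F1 y) 0); [apply HF1| |reflexivity].
      apply is_lim_spec. intros [e He].
      destruct (U (Rabs y + 1) (e / 2) (HX y) ltac:(lra)) as [M0 HM0]. exists M0.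
      intros M HM. rewrite Rminus_0_r. simpl.
      destruct (HM0 M y (Rlt_le _ _ HM) (Hxx y)) as (_ & _ & HB). lra.
    + intros eps He.
      assert (He' : 0 < eps / (Rabs x + 1)) by (apply Rdiv_lt_0_compat; auto).
      destruct (U (Rabs x + 1) _ (HX x) He') as [M0 HM0]. exists M0.
      intros M y HM Hy. destruct (HM0 M y HM Hy) as (H0 & _ & _).
      replace (y * RInt (k0 y) 0 M - y * F y) with (y * (RInt (k0 y) 0 M - F y)) by ring.
      rewrite Rabs_mult. replace eps with ((Rabs x + 1) * (eps / (Rabs x + 1))).
      * apply Rmult_le_compat; auto using Rabs_pos.
      * field. apply Rgt_not_eq, HX.
Qed.

(** * Bounds for cubic oscillatory and exponential integrals *)

Lemma ex_RInt_of_continuous (f : R -> R) (a b : R) : (forall t, continuous f t) -> ex_RInt f a b.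
Proof. intros H. apply (@ex_RInt_continuous R_CompleteNormedModule). intros; apply H. Qed.

Lemma RInt_ext_le (f g : R -> R) (a b : R) :
  a <= b -> (forall t, a < t < b -> f t = g t) -> RInt f a b = RInt g a b.
Proof. intros Hab H. apply RInt_ext. now rewrite Rmin_left, Rmax_right. Qed.

(* Integration by parts against r sin p; the error term - r' sin p is dominated by - r'. *)
Lemma oscillatory_integral_le (r r' p p' : R -> R) (A B : R) :
  A <= B ->
  (forall t, A <= t <= B -> is_derive r t (r' t) /\ is_derive p t (p' t) /\
     continuous r' t /\ continuous p' t /\ r' t <= 0 /\ 0 <= r t) ->
  Rabs (RInt (fun t => r t * p' t * cos (p t)) A B) <= 2 * r A.
Proof.
  intros HAB H.
  assert (Hm : Rmin A B = A) by now apply Rmin_left.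
  assert (HM : Rmax A B = B) by now apply Rmax_right.
  assert (Cp : forall t, A <= t <= B -> continuous p t).
  { intros t Ht. destruct (H t Ht) as (_ & D & _). apply (ex_derive_continuous p). now exists (p' t). }
  assert (Cr : forall t, A <= t <= B -> continuous r t).
  { intros t Ht. destruct (H t Ht) as (D & _). apply (ex_derive_continuous r). now exists (r' t). }
  assert (Cs : forall t, A <= t <= B -> continuous (fun t => sin (p t)) t).
  { intros t Ht. apply (continuous_comp p sin); [now apply Cp|apply continuous_sin]. }
  assert (Cc : forall t, A <= t <= B -> continuous (fun t => cos (p t)) t).
  { intros t Ht. apply (continuous_comp p cos); [now apply Cp|apply continuous_cos]. }
  set (f := fun t => r t * p' t * cos (p t)).
  assert (Cf : forall t, A <= t <= B -> continuous f t).
  { intros t Ht. apply (continuous_mult (fun t => r t * p' t) (fun t => cos (p t))); [|now apply Cc].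
    apply (continuous_mult r p'); [now apply Cr|]. now destruct (H t Ht) as (_ & _ & _ & C & _). }
  assert (Cd : forall t, A <= t <= B -> continuous (fun t => r' t * sin (p t) + f t) t).
  { intros t Ht. apply (continuous_plus (fun t => r' t * sin (p t)) f); [|now apply Cf].
    apply (continuous_mult r' (fun t => sin (p t))); [|now apply Cs]. now destruct (H t Ht) as (_ & _ & C & _). }
  assert (I1 : is_RInt (fun t => r' t * sin (p t) + f t) A B (r B * sin (p B) - r A * sin (p A))).
  { apply (is_RInt_derive (fun t => r t * sin (p t))); rewrite Hm, HM; [|assumption].
    intros t Ht. destruct (H t Ht) as (D1 & D2 & _).
    replace (r' t * sin (p t) + f t) with (plus (mult (r' t) (sin (p t))) (mult (r t) (p' t * cos (p t)))).
    2:{ unfold plus, mult, f; simpl. ring. }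
    apply (is_derive_mult r (fun t => sin (p t))); [assumption| |].
    - apply (is_derive_comp sin p t (cos (p t)) (p' t)); [|assumption]. auto_derive; auto; ring.
    - intros; apply Rmult_comm. }
  assert (I2 : is_RInt r' A B (r B - r A)).
  { apply (is_RInt_derive r); rewrite Hm, HM; intros t Ht; now destruct (H t Ht) as (D & _ & C & _). }
  assert (If : is_RInt f A B (RInt f A B)).
  { apply (@RInt_correct R_CompleteNormedModule), (@ex_RInt_continuous R_CompleteNormedModule).
    now rewrite Hm, HM. }
  assert (Up : RInt f A B <= (r B * sin (p B) - r A * sin (p A)) - (r B - r A)).
  { apply (is_RInt_le f (fun t => (r' t * sin (p t) + f t) - r' t) A B); [assumption|assumption| |].
    - now apply (is_RInt_minus (fun t => r' t * sin (p t) + f t) r').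
    - intros t Ht. destruct (H t ltac:(lra)) as (_ & _ & _ & _ & H1 & _).
      generalize (SIN_bound (p t)). nra. }
  assert (Lo : (r B * sin (p B) - r A * sin (p A)) + (r B - r A) <= RInt f A B).
  { apply (is_RInt_le (fun t => (r' t * sin (p t) + f t) + r' t) f A B); [assumption| |assumption|].
    - now apply (is_RInt_plus (fun t => r' t * sin (p t) + f t) r').
    - intros t Ht. destruct (H t ltac:(lra)) as (_ & _ & _ & _ & H1 & _).
      generalize (SIN_bound (p t)). nra. }
  destruct (H A ltac:(lra)) as (_ & _ & _ & _ & _ & HA).
  destruct (H B ltac:(lra)) as (_ & _ & _ & _ & _ & HB).
  generalize (SIN_bound (p A)) (SIN_bound (p B)). intros.
  (* The terms at [B] combine to r(B) (sin p(B) - 1) <= 0 and, for the lower bound, to r(B) (sin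
     p(B) + 1) >= 0, so only 2 r(A) remains. *)
  apply Rabs_le. fold f. split; nra.
Qed.

Lemma cubic_phase_derive (x c t : R) : is_derive (fun t => t ^ 3 / 3 + x * t + c) t (t ^ 2 + x).
Proof. auto_derive; auto; field. Qed.

Ltac solve_continuous := apply (@ex_derive_continuous R_AbsRing R_NormedModule); auto_derive; auto.

(** The amplitudes 1/(t^2 + x) and t/(t^2 + x) are decreasing once t^2 >= |x|, and A >= 2 X + 2 also
    gives t^2 + x >= t^2/2. The constant phase [c] lets the same bound serve sines. *)
Lemma cos_cubic_tail (x c X A B : R) : Rabs x <= X -> 2 * X + 2 <= A -> A <= B ->
  Rabs (RInt (fun t => cos (t ^ 3 / 3 + x * t + c)) A B) <= 4 / A /\
  Rabs (RInt (fun t => t * cos (t ^ 3 / 3 + x * t + c)) A B) <= 4 / A.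
Proof.
  intros Hx HA HAB. apply Rabs_le_between in Hx.
  assert (Hpos : forall t, A <= t -> t ^ 2 / 2 <= t ^ 2 + x /\ x <= t ^ 2 /\ 0 < t ^ 2).
  { intros t Ht. simpl. repeat split; nra. }
  assert (HA2 : 2 / A ^ 2 <= 1 / A).
  { apply Rmult_le_reg_r with (A ^ 2); [apply Hpos; lra|].
    replace (2 / A ^ 2 * A ^ 2) with 2 by (field; lra).
    replace (1 / A * A ^ 2) with A by (field; lra). lra. }
  assert (Hinv : / (A ^ 2 + x) <= 2 / A ^ 2).
  { destruct (Hpos A) as (H1 & H2 & H3); [lra|].
    replace (2 / A ^ 2) with (/ (A ^ 2 / 2)) by (field; lra). apply Rinv_le_contravar; lra. }
  split.
  - rewrite (RInt_ext_le _ (fun t => / (t ^ 2 + x) * (t ^ 2 + x) * cos (t ^ 3 / 3 + x * t + c))).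
    2: lra.
    2:{ intros t Ht. destruct (Hpos t) as (H1 & H2 & H3); [lra|].
        rewrite Rinv_l, Rmult_1_l by lra. reflexivity. }
    eapply Rle_trans; [apply (oscillatory_integral_le (fun t => / (t ^ 2 + x))
      (fun t => - (2 * t) / (t ^ 2 + x) ^ 2) (fun t => t ^ 3 / 3 + x * t + c) (fun t => t ^ 2 + x)); [lra|]|].
    + intros t Ht. destruct (Hpos t) as (H1 & H2 & H3); [lra|].
      refine (conj _ (conj _ (conj _ (conj _ (conj _ _))))).
      * auto_derive; [lra|]. field; lra.
      * apply cubic_phase_derive.
      * solve_continuous. apply Rgt_not_eq. rewrite Rmult_1_r. apply Rmult_lt_0_compat; simpl in *; lra.
      * solve_continuous.
      * unfold Rdiv. rewrite Ropp_mult_distr_l_reverse.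
        assert (0 <= 2 * t * / (t ^ 2 + x) ^ 2); [|lra].
        apply Rmult_le_pos; [lra|]. apply Rlt_le, Rinv_0_lt_compat, pow_lt; lra.
      * apply Rlt_le, Rinv_0_lt_compat; lra.
    + replace (4 / A) with (2 * (2 * (1 / A))) by (field; lra).
      assert (0 < 1 / A) by (apply Rdiv_lt_0_compat; lra). lra.
  - rewrite (RInt_ext_le _ (fun t => t / (t ^ 2 + x) * (t ^ 2 + x) * cos (t ^ 3 / 3 + x * t + c))).
    2: lra.
    2:{ intros t Ht. destruct (Hpos t) as (H1 & H2 & H3); [lra|].
        field; lra. }
    eapply Rle_trans; [apply (oscillatory_integral_le (fun t => t / (t ^ 2 + x))
      (fun t => (x - t ^ 2) / (t ^ 2 + x) ^ 2) (fun t => t ^ 3 / 3 + x * t + c) (fun t => t ^ 2 + x)); [lra|]|].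
    + intros t Ht. destruct (Hpos t) as (H1 & H2 & H3); [lra|].
      refine (conj _ (conj _ (conj _ (conj _ (conj _ _))))).
      * auto_derive; [lra|]. field; lra.
      * apply cubic_phase_derive.
      * solve_continuous. apply Rgt_not_eq. rewrite Rmult_1_r. apply Rmult_lt_0_compat; simpl in *; lra.
      * solve_continuous.
      * assert (0 <= (t ^ 2 - x) / (t ^ 2 + x) ^ 2).
        { apply Rmult_le_pos; [lra|]. apply Rlt_le, Rinv_0_lt_compat, pow_lt; lra. }
        replace ((x - t ^ 2) / (t ^ 2 + x) ^ 2) with (- ((t ^ 2 - x) / (t ^ 2 + x) ^ 2)) by (field; lra).
        lra.
      * apply Rmult_le_pos; [lra|]. apply Rlt_le, Rinv_0_lt_compat; lra.
    + replace (4 / A) with (2 * (A * (2 / A ^ 2))) by (field; lra).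
      apply Rmult_le_compat_l; [lra|]. apply Rmult_le_compat_l; lra.
Qed.

(** The factor t^2 - x is minus the derivative of the exponent. This explicit integral serves as the
    majorant for the weights 1, t and s. *)
Lemma exp_cubic_RInt (x A B : R) :
  is_RInt (fun t => (t ^ 2 - x) * exp (- (t ^ 3 / 3) + x * t)) A B
    (exp (- (A ^ 3 / 3) + x * A) - exp (- (B ^ 3 / 3) + x * B)).
Proof.
  replace (exp (- (A ^ 3 / 3) + x * A) - exp (- (B ^ 3 / 3) + x * B))
    with (minus (- exp (- (B ^ 3 / 3) + x * B)) (- exp (- (A ^ 3 / 3) + x * A)))
    by (unfold minus, plus, opp; simpl; ring).
  apply (is_RInt_derive (fun t => - exp (- (t ^ 3 / 3) + x * t))).
  - intros t _. auto_derive; auto. change (t * (t * (t * 1)) * / 3) with (t ^ 3 / 3). field.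
  - intros t _. solve_continuous.
Qed.

(** Beyond A both 1 and t are at most t^2 - x, so each tail is at most exp(-A^3/3 + x A) <= exp(-A)
    <= 1/A. *)
Lemma exp_cubic_tail (x X A B : R) : Rabs x <= X -> 2 * X + 2 <= A -> A <= B ->
  exp (- (A ^ 3 / 3) + x * A) <= 1 / A /\
  Rabs (RInt (fun t => exp (- (t ^ 3 / 3) + x * t)) A B) <= 1 / A /\
  Rabs (RInt (fun t => t * exp (- (t ^ 3 / 3) + x * t)) A B) <= 1 / A.
Proof.
  intros Hx HA HAB. apply Rabs_le_between in Hx.
  assert (HeA : exp (- (A ^ 3 / 3) + x * A) <= 1 / A).
  { apply Rle_trans with (exp (- A)).
    - assert (Hle : - (A ^ 3 / 3) + x * A <= - A).
      { replace (- (A ^ 3 / 3) + x * A) with (A * (x - A ^ 2 / 3)) by field.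
        replace (- A) with (A * (-1)) by ring. apply Rmult_le_compat_l; [lra|]. simpl. nra. }
      destruct Hle as [Hlt|Heq]; [left; now apply exp_increasing|rewrite Heq; lra].
    - rewrite exp_Ropp. unfold Rdiv. rewrite Rmult_1_l. apply Rinv_le_contravar; [lra|].
      generalize (exp_ineq1_le A). lra. }
  assert (I := is_RInt_unique _ _ _ _ (exp_cubic_RInt x A B)).
  assert (Ie : ex_RInt (fun t => (t ^ 2 - x) * exp (- (t ^ 3 / 3) + x * t)) A B)
    by (eexists; apply exp_cubic_RInt).
  assert (HeB := exp_pos (- (B ^ 3 / 3) + x * B)).
  assert (Hg : forall g : R -> R, (forall t, continuous g t) -> (forall t, A < t < B -> 0 <= g t <= t ^ 2 - x) ->
    Rabs (RInt (fun t => g t * exp (- (t ^ 3 / 3) + x * t)) A B) <= 1 / A).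
  { intros g Cg Hg.
    assert (Ig : ex_RInt (fun t => g t * exp (- (t ^ 3 / 3) + x * t)) A B).
    { apply ex_RInt_of_continuous. intros t. apply (continuous_mult g); [apply Cg|solve_continuous]. }
    rewrite Rabs_right.
    - eapply Rle_trans; [apply (RInt_le _ _ A B HAB Ig Ie)|rewrite I; lra].
      intros t Ht. apply Rmult_le_compat_r; [apply Rlt_le, exp_pos|now apply Hg].
    - apply Rle_ge. replace 0 with (RInt (fun _ => 0) A B).
      + apply RInt_le; [assumption|apply ex_RInt_const|assumption|].
        intros t Ht. apply Rmult_le_pos; [now apply Hg|apply Rlt_le, exp_pos].
      + rewrite RInt_const. apply Rmult_0_r. }
  split; [assumption|]. split.
  - rewrite (RInt_ext_le _ (fun t => 1 * exp (- (t ^ 3 / 3) + x * t))) by (intros; lra).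
    apply (Hg (fun _ => 1)); [intros; apply continuous_const|]. intros t Ht. simpl; nra.
  - apply (Hg (fun t => t)); [intros; apply continuous_id|]. intros t Ht. simpl; nra.
Qed.

(** At x = -s^2 both s and t are at most (t^2 + s^2)/s, and the explicit integral with weight t^2 +
    s^2 is at most 1. *)
Lemma exp_cubic_RInt_le (s M : R) : 0 < s -> 0 <= M ->
  0 <= s * RInt (fun t => exp (- (t ^ 3 / 3) + - s ^ 2 * t)) 0 M <= / s /\
  0 <= RInt (fun t => t * exp (- (t ^ 3 / 3) + - s ^ 2 * t)) 0 M <= / s.
Proof.
  intros Hs HM.
  assert (I := is_RInt_unique _ _ _ _ (exp_cubic_RInt (- s ^ 2) 0 M)).
  assert (Ie : ex_RInt (fun t => (t ^ 2 - - s ^ 2) * exp (- (t ^ 3 / 3) + - s ^ 2 * t)) 0 M)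
    by (eexists; apply exp_cubic_RInt).
  replace (exp (- (0 ^ 3 / 3) + - s ^ 2 * 0)) with 1 in I by (rewrite <- exp_0; f_equal; field).
  assert (HeB := exp_pos (- (M ^ 3 / 3) + - s ^ 2 * M)).
  assert (Hg : forall (g : R -> R), (forall t, continuous g t) ->
    (forall t, 0 < t < M -> 0 <= g t <= / s * (t ^ 2 - - s ^ 2)) ->
    0 <= RInt (fun t => g t * exp (- (t ^ 3 / 3) + - s ^ 2 * t)) 0 M <= / s).
  { intros g Cg Hg.
    assert (Ig : ex_RInt (fun t => g t * exp (- (t ^ 3 / 3) + - s ^ 2 * t)) 0 M).
    { apply ex_RInt_of_continuous. intros t. apply (continuous_mult g); [apply Cg|solve_continuous]. }
    split.
    - replace 0 with (RInt (fun _ => 0) 0 M) at 1.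
      + apply RInt_le; [assumption|apply ex_RInt_const|assumption|].
        intros t Ht. apply Rmult_le_pos; [now apply Hg|apply Rlt_le, exp_pos].
      + rewrite RInt_const. apply Rmult_0_r.
    - assert (Es : RInt (fun t => / s * ((t ^ 2 - - s ^ 2) * exp (- (t ^ 3 / 3) + - s ^ 2 * t))) 0 M
        = / s * (1 - exp (- (M ^ 3 / 3) + - s ^ 2 * M))).
      { rewrite <- I. apply (RInt_scal (fun t => (t ^ 2 - - s ^ 2) * exp (- (t ^ 3 / 3) + - s ^ 2 * t))).
        assumption. }
      apply Rle_trans with (/ s * (1 - exp (- (M ^ 3 / 3) + - s ^ 2 * M))).
      + rewrite <- Es. apply RInt_le; [assumption|assumption| |].
        * apply ex_RInt_of_continuous. intros. solve_continuous.
        * intros t Ht. rewrite <- Rmult_assoc.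
          apply Rmult_le_compat_r; [apply Rlt_le, exp_pos|]. now apply Hg.
      + assert (0 < / s) by (apply Rinv_0_lt_compat; lra). nra. }
  assert (His : s * / s = 1) by (field; lra).
  assert (Hip : 0 < / s) by (apply Rinv_0_lt_compat; lra).
  split.
  - replace (s * RInt (fun t => exp (- (t ^ 3 / 3) + - s ^ 2 * t)) 0 M)
      with (RInt (fun t => s * exp (- (t ^ 3 / 3) + - s ^ 2 * t)) 0 M).
    2:{ apply (RInt_scal (fun t => exp (- (t ^ 3 / 3) + - s ^ 2 * t))).
        apply ex_RInt_of_continuous. intros; solve_continuous. }
    apply (Hg (fun _ => s)); [intros; apply continuous_const|]. intros t Ht. split; [lra|].
    apply Rmult_le_reg_l with s; [lra|]. rewrite <- Rmult_assoc, His. simpl; nra.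
  - apply (Hg (fun t => t)); [intros; apply continuous_id|]. intros t Ht. split; [lra|].
    apply Rmult_le_reg_l with s; [lra|]. rewrite <- Rmult_assoc, His. simpl; nra.
Qed.

(* On x = - s^2 the phase derivative factors as (t - s) (t + s), so the amplitude t - s
   cancels the stationary point. *)
Lemma cos_cubic_stationary_le (s c M : R) : 0 < s -> 0 <= M ->
  Rabs (RInt (fun t => (t - s) * cos (t ^ 3 / 3 + - s ^ 2 * t + c)) 0 M) <= 2 / s.
Proof.
  intros Hs HM.
  rewrite (RInt_ext_le _ (fun t => / (t + s) * (t ^ 2 + - s ^ 2) * cos (t ^ 3 / 3 + - s ^ 2 * t + c))).
  2: lra.
  2:{ intros t Ht. field; lra. }
  eapply Rle_trans; [apply (oscillatory_integral_le (fun t => / (t + s))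
    (fun t => - / (t + s) ^ 2) (fun t => t ^ 3 / 3 + - s ^ 2 * t + c) (fun t => t ^ 2 + - s ^ 2)); [lra|]|].
  - intros t Ht. refine (conj _ (conj _ (conj _ (conj _ (conj _ _))))).
    + auto_derive; [lra|]. field; lra.
    + apply cubic_phase_derive.
    + solve_continuous. apply Rgt_not_eq. rewrite Rmult_1_r. apply Rmult_lt_0_compat; lra.
    + solve_continuous.
    + assert (0 < / (t + s) ^ 2) by (apply Rinv_0_lt_compat, pow_lt; lra). lra.
    + apply Rlt_le, Rinv_0_lt_compat; lra.
  - rewrite Rplus_0_l. right. unfold Rdiv. ring.
Qed.

(** * The Ai and Bi integrals and the Airy equation *)

Lemma RInt_add_scal (f g : R -> R) (c a b : R) :
  (forall t, continuous f t) -> (forall t, continuous g t) ->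
  RInt (fun t => f t + c * g t) a b = RInt f a b + c * RInt g a b.
Proof.
  intros Cf Cg. apply is_RInt_unique.
  apply (is_RInt_plus f (fun t => c * g t)).
  - apply (@RInt_correct R_CompleteNormedModule), ex_RInt_of_continuous, Cf.
  - apply (is_RInt_scal g a b c).
    apply (@RInt_correct R_CompleteNormedModule), ex_RInt_of_continuous, Cg.
Qed.

Lemma cos_plus_PI2 (y : R) : cos (y + PI / 2) = - sin y.
Proof. rewrite cos_plus, cos_PI2, sin_PI2. ring. Qed.

Lemma cos_minus_PI2 (y : R) : cos (y + - (PI / 2)) = sin y.
Proof. rewrite cos_plus, cos_neg, sin_neg, cos_PI2, sin_PI2. ring. Qed.

Lemma continuity_2d_snd (f : R -> R) (x t : R) :
  continuous f t -> continuity_2d_pt (fun _ v => f v) x t.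
Proof.
  intros Hf. apply (continuity_1d_2d_pt_comp f (fun _ v => v)); [|apply continuity_2d_pt_id2].
  now apply continuity_pt_filterlim.
Qed.

Lemma continuity_2d_cubic (f : R -> R) (c x t : R) :
  (forall y, continuous f y) -> continuity_2d_pt (fun u v => f (c * (v ^ 3 / 3) + u * v)) x t.
Proof.
  intros Hf. apply (continuity_1d_2d_pt_comp f (fun u v => c * (v ^ 3 / 3) + u * v)).
  - apply continuity_pt_filterlim, Hf.
  - apply continuity_2d_pt_plus.
    + apply (continuity_2d_snd (fun v => c * (v ^ 3 / 3))). solve_continuous.
    + apply continuity_2d_pt_mult; [apply continuity_2d_pt_id1|apply continuity_2d_pt_id2].
Qed.

Lemma continuity_2d_cubic_mult (f g : R -> R) (c x t : R) :
  (forall y, continuous f y) -> (forall y, continuous g y) ->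
  continuity_2d_pt (fun u v => g v * f (c * (v ^ 3 / 3) + u * v)) x t.
Proof.
  intros Hf Hg. apply continuity_2d_pt_mult; [|now apply continuity_2d_cubic].
  now apply continuity_2d_snd.
Qed.

Definition airy_exp (x t : R) : R := exp (- (t ^ 3 / 3) + x * t).
Definition airy_sin (x t : R) : R := sin (t ^ 3 / 3 + x * t).
Definition airy_cos (x t : R) : R := cos (t ^ 3 / 3 + x * t).

Lemma continuity_2d_airy_exp (g : R -> R) (x t : R) :
  (forall y, continuous g y) -> continuity_2d_pt (fun u v => g v * airy_exp u v) x t.
Proof.
  intros Hg. apply continuity_2d_pt_ext with (fun u v => g v * exp ((-1) * (v ^ 3 / 3) + u * v)).
  - intros u v. unfold airy_exp. do 2 f_equal. ring.
  - apply (continuity_2d_cubic_mult exp g (-1)); [|assumption]. intros; solve_continuous.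
Qed.

Lemma continuity_2d_airy_sin (g : R -> R) (x t : R) :
  (forall y, continuous g y) -> continuity_2d_pt (fun u v => g v * airy_sin u v) x t.
Proof.
  intros Hg. apply continuity_2d_pt_ext with (fun u v => g v * sin (1 * (v ^ 3 / 3) + u * v)).
  - intros u v. unfold airy_sin. do 2 f_equal. ring.
  - apply (continuity_2d_cubic_mult sin g 1); [|assumption]. intros; apply continuous_sin.
Qed.

Lemma continuity_2d_airy_cos (g : R -> R) (x t : R) :
  (forall y, continuous g y) -> continuity_2d_pt (fun u v => g v * airy_cos u v) x t.
Proof.
  intros Hg. apply continuity_2d_pt_ext with (fun u v => g v * cos (1 * (v ^ 3 / 3) + u * v)).
  - intros u v. unfold airy_cos. do 2 f_equal. ring.
  - apply (continuity_2d_cubic_mult cos g 1); [|assumption]. intros; apply continuous_cos.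
Qed.

Lemma continuous_kernel (k : R -> R -> R) (g : R -> R) (x t : R) :
  (forall x t, continuity_2d_pt (fun u v => g v * k u v) x t) -> continuous (fun v => g v * k x v) t.
Proof. intros H. apply (continuous_section (fun u v => g v * k u v)), H. Qed.

Lemma RInt_airy_cos_tail (x X A B : R) : Rabs x <= X -> 2 * X + 2 <= A -> A <= B ->
  Rabs (RInt (fun t => airy_cos x t) A B) <= 4 / A /\ Rabs (RInt (fun t => t * airy_cos x t) A B) <= 4 / A.
Proof.
  intros Hx HA HAB. destruct (cos_cubic_tail x 0 X A B Hx HA HAB) as [H0 H1].
  split; [rewrite <- (RInt_ext_le (fun t => cos (t ^ 3 / 3 + x * t + 0)))
         |rewrite <- (RInt_ext_le (fun t => t * cos (t ^ 3 / 3 + x * t + 0)))];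
  try assumption; intros; unfold airy_cos; now rewrite Rplus_0_r.
Qed.

(** The sine is the cosine shifted by -PI/2, while the sign in -t sin calls for the shift by
    +PI/2. *)
Lemma RInt_airy_sin_tail (x X A B : R) : Rabs x <= X -> 2 * X + 2 <= A -> A <= B ->
  Rabs (RInt (fun t => airy_sin x t) A B) <= 4 / A /\ Rabs (RInt (fun t => - t * airy_sin x t) A B) <= 4 / A.
Proof.
  intros Hx HA HAB.
  destruct (cos_cubic_tail x (- (PI / 2)) X A B Hx HA HAB) as [H0 _].
  destruct (cos_cubic_tail x (PI / 2) X A B Hx HA HAB) as [_ H1].
  split; [rewrite <- (RInt_ext_le (fun t => cos (t ^ 3 / 3 + x * t + - (PI / 2))))
         |rewrite <- (RInt_ext_le (fun t => t * cos (t ^ 3 / 3 + x * t + PI / 2)))];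
  try assumption; intros; unfold airy_sin; rewrite ?cos_plus_PI2, ?cos_minus_PI2; ring.
Qed.

(** The 5 is the 4/A of an oscillatory tail plus the 1/A of an exponential one. *)
Lemma tail_threshold (X eps M1 : R) : 0 < X -> 0 < eps -> 2 * X + 2 + 5 / eps <= M1 ->
  2 * X + 2 <= M1 /\ 5 / M1 <= eps.
Proof.
  intros HX He HM. assert (0 < 5 / eps) by (apply Rdiv_lt_0_compat; lra). split; [lra|].
  apply Rmult_le_reg_r with M1; [lra|]. replace (5 / M1 * M1) with 5 by (field; lra).
  apply Rle_trans with (eps * (5 / eps)); [right; field; lra|]. apply Rmult_le_compat_l; lra.
Qed.

Lemma div_le_of_abs_le (y c d M : R) : 0 < M -> Rabs y <= c -> c <= d -> Rabs (y / M) <= d / M.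
Proof.
  intros HM Hy Hc. unfold Rdiv. rewrite Rabs_mult, Rabs_inv, (Rabs_right M) by lra.
  apply Rmult_le_compat_r; [|lra]. apply Rlt_le, Rinv_0_lt_compat; lra.
Qed.

(** Here k2 - x k0 = -(t^2 + x) cos is the t-derivative of b = -sin, which vanishes at t = 0, and B
    = cos/t is an x-antiderivative of b that decays like 1/t. *)
Theorem Ai_integral_solution : exists a a1 : R -> R, forall x,
  is_lim (fun M => RInt (airy_cos x) 0 M) p_infty (a x) /\
  is_lim (fun M => RInt (fun t => - t * airy_sin x t) 0 M) p_infty (a1 x) /\
  is_derive a x (a1 x) /\ is_derive a1 x (x * a x).
Proof.
  apply (airy_equation_of_kernel airy_cos (fun x t => - t * airy_sin x t) (fun x t => - t ^ 2 * airy_cos x t)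
    (fun x t => - airy_sin x t) (fun x t => airy_cos x t / t)).
  - intros. unfold airy_cos, airy_sin. auto_derive; auto. change (t * (t * (t * 1))) with (t ^ 3); try change (t ^ 3 * / 3) with (t ^ 3 / 3). field.
  - intros. unfold airy_cos, airy_sin. auto_derive; auto. change (t * (t * (t * 1))) with (t ^ 3); try change (t ^ 3 * / 3) with (t ^ 3 / 3). field.
  - intros. apply continuity_2d_pt_ext with (fun u v => 1 * airy_cos u v); [intros; ring|].
    apply (continuity_2d_airy_cos (fun _ => 1)). intros; apply continuous_const.
  - intros. apply (continuity_2d_airy_sin (fun v => - v)). intros; solve_continuous.
  - intros. apply (continuity_2d_airy_cos (fun v => - v ^ 2)). intros; solve_continuous.
  - intros. unfold airy_cos, airy_sin. auto_derive; auto.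
    change (t * (t * (t * 1))) with (t ^ 3); try change (t ^ 3 * / 3) with (t ^ 3 / 3). field.
  - intros. unfold airy_sin. replace (0 ^ 3 / 3 + x * 0) with 0 by field. rewrite sin_0. ring.
  - intros. unfold airy_cos, airy_sin. auto_derive; auto. change (t * (t * (t * 1))) with (t ^ 3); try change (t ^ 3 * / 3) with (t ^ 3 / 3). field. lra.
  - intros X eps HX He. exists (2 * X + 2 + 5 / eps). intros M1 M2 x H1 H2 Hx.
    destruct (tail_threshold X eps M1 HX He H1) as [HA He'].
    destruct (RInt_airy_cos_tail x X M1 M2 Hx HA H2) as [T0 _].
    destruct (RInt_airy_sin_tail x X M1 M2 Hx HA H2) as [_ T1].
    assert (H45 : 4 / M1 <= 5 / M1)
      by (apply Rmult_le_compat_r; [apply Rlt_le, Rinv_0_lt_compat; lra|lra]).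
    change (RInt (airy_cos x) M1 M2) with (RInt (fun t => airy_cos x t) M1 M2).
    split; [lra|]. split; [lra|].
    assert (Rabs (airy_cos x M1 / M1) <= 5 / M1); [|lra].
    apply (div_le_of_abs_le _ 1); try lra. apply Rabs_le, COS_bound.
Qed.

(** Here k2 - x k0 = (t^2 - x) exp - (t^2 + x) sin is the t-derivative of b = cos - exp. The two
    boundary values at t = 0 cancel, which is why the exponential and the sine must appear together;
    B = (sin - exp)/t. *)
Theorem Bi_integral_solution : exists b b1 : R -> R, forall x,
  is_lim (fun M => RInt (fun t => airy_exp x t + airy_sin x t) 0 M) p_infty (b x) /\
  is_lim (fun M => RInt (fun t => t * airy_exp x t + t * airy_cos x t) 0 M) p_infty (b1 x) /\
  is_derive b x (b1 x) /\ is_derive b1 x (x * b x).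
Proof.
  assert (CE : forall (g : R -> R) x t, (forall y, continuous g y) -> continuous (fun v => g v * airy_exp x v) t).
  { intros g x t Hg. apply (continuous_kernel airy_exp g). intros; now apply continuity_2d_airy_exp. }
  apply (airy_equation_of_kernel (fun x t => airy_exp x t + airy_sin x t)
    (fun x t => t * airy_exp x t + t * airy_cos x t) (fun x t => t ^ 2 * airy_exp x t + - t ^ 2 * airy_sin x t)
    (fun x t => airy_cos x t - airy_exp x t) (fun x t => (airy_sin x t - airy_exp x t) / t)).
  - intros. unfold airy_exp, airy_cos, airy_sin. auto_derive; auto. change (t * (t * (t * 1))) with (t ^ 3); try change (t ^ 3 * / 3) with (t ^ 3 / 3). field.
  - intros. unfold airy_exp, airy_cos, airy_sin. auto_derive; auto. change (t * (t * (t * 1))) with (t ^ 3); try change (t ^ 3 * / 3) with (t ^ 3 / 3). field.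
  - intros. apply continuity_2d_pt_ext with (fun u v => 1 * airy_exp u v + 1 * airy_sin u v); [intros; ring|].
    apply continuity_2d_pt_plus; [apply (continuity_2d_airy_exp (fun _ => 1))|apply (continuity_2d_airy_sin (fun _ => 1))];
    intros; apply continuous_const.
  - intros. apply continuity_2d_pt_plus; [apply (continuity_2d_airy_exp (fun v => v))|apply (continuity_2d_airy_cos (fun v => v))];
    intros; apply continuous_id.
  - intros. apply continuity_2d_pt_plus; [apply (continuity_2d_airy_exp (fun v => v ^ 2))|apply (continuity_2d_airy_sin (fun v => - v ^ 2))];
    intros; solve_continuous.
  - intros. unfold airy_exp, airy_cos, airy_sin. auto_derive; auto.
    change (t * (t * (t * 1))) with (t ^ 3); try change (t ^ 3 * / 3) with (t ^ 3 / 3). field.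
  - intros. unfold airy_exp, airy_cos. replace (0 ^ 3 / 3 + x * 0) with 0 by field.
    replace (- (0 ^ 3 / 3) + x * 0) with 0 by field. rewrite cos_0, exp_0. ring.
  - intros. unfold airy_exp, airy_cos, airy_sin. auto_derive; auto. change (t * (t * (t * 1))) with (t ^ 3); try change (t ^ 3 * / 3) with (t ^ 3 / 3). field. lra.
  - intros X eps HX He. exists (2 * X + 2 + 5 / eps). intros M1 M2 x H1 H2 Hx.
    destruct (tail_threshold X eps M1 HX He H1) as [HA He'].
    destruct (RInt_airy_cos_tail x X M1 M2 Hx HA H2) as [_ T1].
    destruct (RInt_airy_sin_tail x X M1 M2 Hx HA H2) as [T0 _].
    destruct (exp_cubic_tail x X M1 M2 Hx HA H2) as (Ee & E0 & E1).
    fold (airy_exp x M1) in Ee.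
    change (Rabs (RInt (fun t => airy_exp x t) M1 M2) <= 1 / M1) in E0.
    change (Rabs (RInt (fun t => t * airy_exp x t) M1 M2) <= 1 / M1) in E1.
    assert (H45 : 1 / M1 + 4 / M1 = 5 / M1) by (field; lra).
    split; [|split].
    + rewrite (RInt_ext_le _ (fun t => 1 * airy_exp x t + 1 * (1 * airy_sin x t))) by (intros; lra).
      rewrite (RInt_add_scal (fun t => 1 * airy_exp x t) (fun t => 1 * airy_sin x t)).
      * rewrite (RInt_ext_le _ (fun t => airy_exp x t)), (RInt_ext_le (fun t => 1 * airy_sin x t) (fun t => airy_sin x t)) by (intros; lra).
        eapply Rle_trans; [apply Rabs_triang|]. rewrite Rmult_1_l. lra.
      * intros. apply (CE (fun _ => 1)). intros; apply continuous_const.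
      * intros. apply (continuous_kernel airy_sin (fun _ => 1)). intros. apply (continuity_2d_airy_sin (fun _ => 1)).
        intros; apply continuous_const.
    + rewrite (RInt_ext_le _ (fun t => t * airy_exp x t + 1 * (t * airy_cos x t))) by (intros; lra).
      rewrite (RInt_add_scal (fun t => t * airy_exp x t) (fun t => t * airy_cos x t)).
      * eapply Rle_trans; [apply Rabs_triang|]. rewrite Rmult_1_l. lra.
      * intros. apply (CE (fun t => t)). intros; apply continuous_id.
      * intros. apply (continuous_kernel airy_cos (fun t => t)). intros. apply (continuity_2d_airy_cos (fun t => t)).
        intros; apply continuous_id.
    + assert (Rabs ((airy_sin x M1 - airy_exp x M1) / M1) <= 5 / M1); [|lra].
      assert (0 < airy_exp x M1) by apply exp_pos.
      assert (1 / M1 <= 1) by (apply Rmult_le_reg_r with M1; [lra|]; unfold Rdiv; rewrite Rmult_assoc, Rinv_l by lra; lra).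
      apply (div_le_of_abs_le _ 2); try lra.
      generalize (SIN_bound (M1 ^ 3 / 3 + x * M1)). fold (airy_sin x M1). intros. apply Rabs_le; lra.
Qed.

Lemma continuous_airy_exp (g : R -> R) (x t : R) : (forall y, continuous g y) -> continuous (fun v => g v * airy_exp x v) t.
Proof. intros Hg. apply (continuous_kernel airy_exp g). intros; now apply continuity_2d_airy_exp. Qed.

Lemma continuous_airy_sin (g : R -> R) (x t : R) : (forall y, continuous g y) -> continuous (fun v => g v * airy_sin x v) t.
Proof. intros Hg. apply (continuous_kernel airy_sin g). intros; now apply continuity_2d_airy_sin. Qed.

Lemma continuous_airy_cos (g : R -> R) (x t : R) : (forall y, continuous g y) -> continuous (fun v => g v * airy_cos x v) t.
Proof. intros Hg. apply (continuous_kernel airy_cos g). intros; now apply continuity_2d_airy_cos. Qed.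

Lemma continuous_airy_exp_plus_airy_sin (x t : R) : continuous (fun v => airy_exp x v + airy_sin x v) t.
Proof. unfold airy_exp, airy_sin. solve_continuous. Qed.

(** Up to sign this is the real part of w_s - i sqrt(s) w, truncated at M and written with s^2 in
    place of s. The cosines combine to the amplitude t - s, costing 2/s, and the exponential part
    costs 1/s. *)
Lemma RInt_Bi_derive_minus (s M : R) : 0 < s -> 0 <= M ->
  Rabs (RInt (fun t => t * airy_exp (- s ^ 2) t + t * airy_cos (- s ^ 2) t) 0 M - s * RInt (airy_cos (- s ^ 2)) 0 M) <= 3 / s.
Proof.
  intros Hs HM. set (x := - s ^ 2).
  replace (RInt (fun t => t * airy_exp x t + t * airy_cos x t) 0 M - s * RInt (airy_cos x) 0 M)
    with (RInt (fun t => t * airy_exp x t) 0 M + 1 * RInt (fun t => (t - s) * airy_cos x t) 0 M).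
  - destruct (exp_cubic_RInt_le s M Hs HM) as [_ He].
    assert (Hc := cos_cubic_stationary_le s 0 M Hs HM).
    rewrite (RInt_ext_le _ (fun t => (t - s) * airy_cos x t)) in Hc by
      (try assumption; intros; unfold airy_cos, x; now rewrite Rplus_0_r).
    change (0 <= RInt (fun t => t * airy_exp x t) 0 M <= / s) in He.
    apply Rabs_le_between in Hc. apply Rabs_le. unfold Rdiv in *. lra.
  - transitivity (RInt (fun t => (t * airy_exp x t + t * airy_cos x t) + (- s) * (1 * airy_cos x t)) 0 M).
    + rewrite <- RInt_add_scal.
      * apply RInt_ext_le; [assumption|]. intros; ring.
      * intros. apply (continuous_airy_exp (fun t => t)). intros; apply continuous_id.
      * intros. apply (continuous_airy_cos (fun t => t - s)). intros; solve_continuous.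
    + rewrite (RInt_add_scal (fun t => t * airy_exp x t + t * airy_cos x t) (fun t => 1 * airy_cos x t)).
      * rewrite (RInt_ext_le (fun t => 1 * airy_cos x t) (airy_cos x)); [ring|assumption|intros; lra].
      * intros. apply (continuous_plus (fun t => t * airy_exp x t) (fun t => t * airy_cos x t)).
        -- apply (continuous_airy_exp (fun t => t)). intros; apply continuous_id.
        -- apply (continuous_airy_cos (fun t => t)). intros; apply continuous_id.
      * intros. apply (continuous_airy_cos (fun t => 1)). intros; apply continuous_const.
Qed.

(** The imaginary counterpart: the sines combine to the amplitude s - t, and the phase shift PI/2
    reduces them to the same stationary bound. *)
Lemma RInt_Ai_derive_plus (s M : R) : 0 < s -> 0 <= M ->
  Rabs (RInt (fun t => - t * airy_sin (- s ^ 2) t) 0 M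
        + s * RInt (fun t => airy_exp (- s ^ 2) t + airy_sin (- s ^ 2) t) 0 M) <= 3 / s.
Proof.
  intros Hs HM. set (x := - s ^ 2).
  replace (RInt (fun t => - t * airy_sin x t) 0 M + s * RInt (fun t => airy_exp x t + airy_sin x t) 0 M)
    with (RInt (fun t => (s - t) * airy_sin x t) 0 M + s * RInt (fun t => 1 * airy_exp x t) 0 M).
  - destruct (exp_cubic_RInt_le s M Hs HM) as [He _].
    assert (Hc := cos_cubic_stationary_le s (PI / 2) M Hs HM).
    rewrite (RInt_ext_le _ (fun t => (s - t) * airy_sin x t)) in Hc by
      (try assumption; intros; unfold airy_sin, x; rewrite cos_plus_PI2; ring).
    rewrite (RInt_ext_le (fun t => 1 * airy_exp x t) (airy_exp x)) by (try assumption; intros; lra).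
    change (0 <= s * RInt (airy_exp x) 0 M <= / s) in He.
    apply Rabs_le_between in Hc. apply Rabs_le. unfold Rdiv in *. lra.
  - transitivity (RInt (fun t => - t * airy_sin x t + s * (airy_exp x t + airy_sin x t)) 0 M).
    + rewrite <- RInt_add_scal.
      * apply RInt_ext_le; [assumption|]. intros; ring.
      * intros. apply (continuous_airy_sin (fun t => s - t)). intros; solve_continuous.
      * intros. apply (continuous_airy_exp (fun t => 1)). intros; apply continuous_const.
    + apply RInt_add_scal.
      * intros. apply (continuous_airy_sin (fun t => - t)). intros; solve_continuous.
      * intros. apply continuous_airy_exp_plus_airy_sin.
Qed.

Lemma RInt_ge_const (f : R -> R) (c a b : R) : a <= b -> (forall t, continuous f t) ->
  (forall t, a < t < b -> c <= f t) -> (b - a) * c <= RInt f a b.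
Proof.
  intros Hab Cf Hf. replace ((b - a) * c) with (RInt (fun _ => c) a b) by apply (RInt_const a b c).
  apply RInt_le; [assumption|apply ex_RInt_const|now apply ex_RInt_of_continuous|assumption].
Qed.

(** This supplies Bi(0) > 0, the nontriviality used for the Wronskian. On [0, 2] the sine is
    nonnegative because t^3/3 <= 8/3 < PI; on [0, 1] the exponential is at least 2/3; beyond 2 the
    oscillatory bound loses at most 2/2^2. The total is 2/3 - 1/2. *)
Lemma RInt_Bi_0_ge (M : R) : 2 <= M -> 1 / 6 <= RInt (fun t => airy_exp 0 t + airy_sin 0 t) 0 M.
Proof.
  intros HM.
  assert (C := continuous_airy_exp_plus_airy_sin 0).
  assert (E : forall a b, ex_RInt (fun t => airy_exp 0 t + airy_sin 0 t) a b)
    by (intros; now apply ex_RInt_of_continuous).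
  rewrite <- (RInt_Chasles _ 0 2 M), <- (RInt_Chasles _ 0 1 2) by apply E.
  unfold plus; simpl.
  assert (Hpos : forall t, 0 < t < 2 -> 0 <= airy_sin 0 t).
  { intros t Ht. unfold airy_sin. rewrite Rmult_0_l, Rplus_0_r.
    assert (Hc : 0 <= t ^ 3 <= 2 ^ 3) by (split; [apply pow_le|apply pow_incr]; lra).
    generalize PI2_3_2; intros. apply sin_ge_0; simpl in *; lra. }
  assert (H1 : (1 - 0) * (2 / 3) <= RInt (fun t => airy_exp 0 t + airy_sin 0 t) 0 1).
  { apply RInt_ge_const; [lra|assumption|]. intros t Ht.
    specialize (Hpos t ltac:(lra)). unfold airy_exp.
    assert (Hc : 0 <= t ^ 3 <= 1 ^ 3) by (split; [apply pow_le|apply pow_incr]; lra).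
    generalize (exp_ineq1_le (- (t ^ 3 / 3) + 0 * t)). simpl in *. lra. }
  assert (H2 : (2 - 1) * 0 <= RInt (fun t => airy_exp 0 t + airy_sin 0 t) 1 2).
  { apply RInt_ge_const; [lra|assumption|]. intros t Ht.
    specialize (Hpos t ltac:(lra)). assert (0 < airy_exp 0 t) by apply exp_pos. lra. }
  assert (H3 : - (1 / 2) <= RInt (fun t => airy_exp 0 t + airy_sin 0 t) 2 M).
  { apply Rle_trans with (RInt (fun t => 1 * airy_sin 0 t) 2 M).
    - rewrite (RInt_ext_le _ (fun t => / t ^ 2 * (t ^ 2 + 0) * cos (t ^ 3 / 3 + 0 * t + - (PI / 2)))).
      2: assumption.
      2:{ intros t Ht. rewrite cos_minus_PI2. unfold airy_sin. field. lra. }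
      assert (Ho := oscillatory_integral_le (fun t => / t ^ 2) (fun t => - (2 * t) / (t ^ 2) ^ 2)
        (fun t => t ^ 3 / 3 + 0 * t + - (PI / 2)) (fun t => t ^ 2 + 0) 2 M HM).
      cbv beta in Ho. apply Rabs_le_between in Ho; [simpl (2 ^ 2) in Ho; lra|].
      intros t Ht. assert (0 < t ^ 2) by (apply pow_lt; lra).
      refine (conj _ (conj _ (conj _ (conj _ (conj _ _))))).
      + auto_derive; [simpl in *; lra|]. field; lra.
      + apply cubic_phase_derive.
      + solve_continuous. apply Rgt_not_eq. repeat apply Rmult_lt_0_compat; lra.
      + solve_continuous.
      + assert (0 < 2 * t / (t ^ 2) ^ 2) by (apply Rdiv_lt_0_compat; [|apply pow_lt]; lra).
        replace (- (2 * t) / (t ^ 2) ^ 2) with (- (2 * t / (t ^ 2) ^ 2)) by (field; lra). lra.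
      + apply Rlt_le, Rinv_0_lt_compat; lra.
    - apply RInt_le; [assumption| |apply E|].
      + apply ex_RInt_of_continuous. intros. apply (continuous_airy_sin (fun _ => 1)). intros; apply continuous_const.
      + intros t Ht. assert (0 < airy_exp 0 t) by apply exp_pos. lra. }
  lra.
Qed.

(** Bounds uniform in the truncation M pass to the limit. From here on the Airy functions enter only
    through these properties of PI Ai and PI Bi. *)
Theorem airy_solution_pair : exists a a1 b b1 : R -> R,
  (forall x, Ai x = a x / PI /\ Bi x = b x / PI) /\
  (forall x, is_derive a x (a1 x) /\ is_derive a1 x (x * a x)) /\
  (forall x, is_derive b x (b1 x) /\ is_derive b1 x (x * b x)) /\
  (forall s, 0 < s -> Rabs (b1 (- s ^ 2) - s * a (- s ^ 2)) <= 3 / s /\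
                      Rabs (a1 (- s ^ 2) + s * b (- s ^ 2)) <= 3 / s) /\
  0 < b 0.
Proof.
  destruct Ai_integral_solution as (a & a1 & Ha). destruct Bi_integral_solution as (b & b1 & Hb).
  exists a, a1, b, b1. split; [|split; [|split; [|split]]].
  - intros x. destruct (Ha x) as (La & _). destruct (Hb x) as (Lb & _).
    apply is_lim_unique in La. apply is_lim_unique in Lb.
    unfold Ai, Bi. split.
    + change (fun M => RInt (fun t => cos (t ^ 3 / 3 + x * t)) 0 M) with (fun M => RInt (airy_cos x) 0 M).
      now rewrite La.
    + change (fun M => RInt (fun t => exp (- (t ^ 3 / 3) + x * t) + sin (t ^ 3 / 3 + x * t)) 0 M)
        with (fun M => RInt (fun t => airy_exp x t + airy_sin x t) 0 M).
      now rewrite Lb.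
  - intros x. apply (Ha x).
  - intros x. apply (Hb x).
  - intros s Hs. destruct (Ha (- s ^ 2)) as (La & La1 & _). destruct (Hb (- s ^ 2)) as (Lb & Lb1 & _).
    split.
    + apply (is_lim_Rabs_le (fun M => RInt (fun t => t * airy_exp (- s ^ 2) t + t * airy_cos (- s ^ 2) t) 0 M
        - s * RInt (airy_cos (- s ^ 2)) 0 M) _ _ 0).
      * apply (is_lim_minus _ _ p_infty (b1 (- s ^ 2)) (s * a (- s ^ 2))); [assumption| |reflexivity].
        now apply (is_lim_scal_l _ s p_infty (a (- s ^ 2))).
      * intros. now apply RInt_Bi_derive_minus.
    + apply (is_lim_Rabs_le (fun M => RInt (fun t => - t * airy_sin (- s ^ 2) t) 0 M
        + s * RInt (fun t => airy_exp (- s ^ 2) t + airy_sin (- s ^ 2) t) 0 M) _ _ 0).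
      * apply (is_lim_plus _ _ p_infty (a1 (- s ^ 2)) (s * b (- s ^ 2))); [assumption| |reflexivity].
        now apply (is_lim_scal_l _ s p_infty (b (- s ^ 2))).
      * intros. now apply RInt_Ai_derive_plus.
  - destruct (Hb 0) as (Lb & _).
    assert (H : Rbar_le (1 / 6) (b 0)).
    { apply (is_lim_le_loc (fun _ => 1 / 6) (fun M => RInt (fun t => airy_exp 0 t + airy_sin 0 t) 0 M) p_infty).
      - exists 2. intros M HM. apply RInt_Bi_0_ge; lra.
      - apply is_lim_const.
      - assumption. }
    simpl in H. lra.
Qed.

(** * Phase velocity of an Airy system *)

Lemma le_of_derive_nonneg (f df : R -> R) (a b : R) : a <= b ->
  (forall t, a <= t <= b -> is_derive f t (df t) /\ 0 <= df t) -> f a <= f b.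
Proof.
  intros Hab H. destruct (MVT_gen f a b df) as (c & Hc & He).
  - intros t. rewrite Rmin_left, Rmax_right by assumption. intros Ht. apply H; lra.
  - intros t. rewrite Rmin_left, Rmax_right by assumption. intros Ht.
    apply derivable_continuous_pt. exists (df t). apply is_derive_Reals, H; lra.
  - rewrite Rmin_left, Rmax_right in Hc by assumption. destruct (H c Hc) as [_ Hp].
    assert (0 <= df c * (b - a)) by (apply Rmult_le_pos; lra). lra.
Qed.

Lemma nonpos_of_le_div (x c s0 : R) : 0 <= c -> 0 < s0 -> (forall s, s0 <= s -> x <= c / s) -> x <= 0.
Proof.
  intros Hc Hs H. destruct (Rle_lt_dec x 0) as [|Hx]; [assumption|exfalso].
  set (s := s0 + 2 * c / x).
  assert (0 <= 2 * c / x) by (apply Rmult_le_pos; [lra|apply Rlt_le, Rinv_0_lt_compat; lra]).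
  specialize (H s ltac:(unfold s; lra)).
  assert (Hxs : x * s <= c).
  { apply Rle_trans with (c / s * s); [apply Rmult_le_compat_r; unfold s in *; lra|].
    right. field. unfold s; lra. }
  assert (x * s = x * s0 + 2 * c) by (unfold s; field; lra).
  assert (0 < x * s0) by (apply Rmult_lt_0_compat; lra). lra.
Qed.

Section AirySystem.

(** In the application u + i v is PI w as a function of s = -x, which turns y'' = x y into y'' = -s
    y. The first-order bounds are stated at s = r^2 to keep square roots out of the algebra. *)
Variables (u u1 v v1 : R -> R) (C : R).
Hypothesis Du : forall s, is_derive u s (u1 s).
Hypothesis Du1 : forall s, is_derive u1 s (- s * u s).
Hypothesis Dv : forall s, is_derive v s (v1 s).
Hypothesis Dv1 : forall s, is_derive v1 s (- s * v s).
Hypothesis Hu1 : forall r, 0 < r -> Rabs (u1 (r ^ 2) + r * v (r ^ 2)) <= C / r.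
Hypothesis Hv1 : forall r, 0 < r -> Rabs (v1 (r ^ 2) - r * u (r ^ 2)) <= C / r.
Hypothesis u0 : u 0 <> 0.

Let W := u 0 * v1 0 - v 0 * u1 0.

(** The eta-expanded functions are the form in which [auto_derive] leaves its derivatives. *)
Lemma derive_eqs (s : R) :
  Derive (fun x => u x) s = u1 s /\ Derive (fun x => u1 x) s = - s * u s /\
  Derive (fun x => v x) s = v1 s /\ Derive (fun x => v1 x) s = - s * v s.
Proof. repeat split; now apply is_derive_unique. Qed.

Lemma derive_exs (s : R) :
  ex_derive (fun x => u x) s /\ ex_derive (fun x => u1 x) s /\
  ex_derive (fun x => v x) s /\ ex_derive (fun x => v1 x) s.
Proof.
  refine (conj _ (conj _ (conj _ _))).
  - now exists (u1 s).
  - now exists (- s * u s).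
  - now exists (v1 s).
  - now exists (- s * v s).
Qed.

Lemma wronskian_const (s : R) : 0 <= s -> u s * v1 s - v s * u1 s = W.
Proof.
  intros [Hs|<-]; [|reflexivity]. symmetry. unfold W.
  apply (eq_is_derive (fun s => u s * v1 s - v s * u1 s) 0 s); [|assumption].
  intros t _. destruct (derive_eqs t) as (E1 & E2 & E3 & E4).
  destruct (derive_exs t) as (X1 & X2 & X3 & X4).
  auto_derive; [tauto|]. rewrite E1, E2, E3, E4. unfold zero; simpl. ring.
Qed.

(** Replacing u1 by -r v and v1 by r u turns the Wronskian into r (u^2 + v^2); the cross term is the
    error. A weighted arithmetic-geometric inequality bounds it by a quarter of the main term plus
    O(r^(-3)), so [W] controls the amplitude from both sides. *)
Lemma wronskian_cross (r : R) : 0 < r ->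
  let s := r ^ 2 in
  W = r * (u s ^ 2 + v s ^ 2) + (u s * (v1 s - r * u s) - v s * (u1 s + r * v s)) /\
  Rabs (u s * (v1 s - r * u s) - v s * (u1 s + r * v s))
    <= r / 4 * (u s ^ 2 + v s ^ 2) + 2 * C ^ 2 / r ^ 3.
Proof.
  intros Hr s. split.
  - rewrite <- (wronskian_const s) by (apply pow2_ge_0). ring.
  - assert (H1 := Hu1 r Hr). assert (H2 := Hv1 r Hr). fold s in H1, H2.
    set (d1 := u1 s + r * v s) in *. set (d2 := v1 s - r * u s) in *.
    assert (amgm : forall x d, Rabs d <= C / r -> Rabs (x * d) <= r / 4 * x ^ 2 + C ^ 2 / r ^ 3).
    { intros x d Hd.
      assert (Hd2 : d ^ 2 / r <= C ^ 2 / r ^ 3).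
      { replace (C ^ 2 / r ^ 3) with ((C / r) ^ 2 / r) by (field; lra).
        apply Rmult_le_compat_r; [apply Rlt_le, Rinv_0_lt_compat; lra|].
        rewrite <- (pow2_abs d). apply pow_incr. split; [apply Rabs_pos|assumption]. }
      assert (Hp : 0 <= r * (x / 2 - d / r) ^ 2) by (apply Rmult_le_pos; [lra|apply pow2_ge_0]).
      assert (Hm : 0 <= r * (x / 2 + d / r) ^ 2) by (apply Rmult_le_pos; [lra|apply pow2_ge_0]).
      replace (r * (x / 2 - d / r) ^ 2) with (r / 4 * x ^ 2 + d ^ 2 / r - x * d) in Hp by (field; lra).
      replace (r * (x / 2 + d / r) ^ 2) with (r / 4 * x ^ 2 + d ^ 2 / r + x * d) in Hm by (field; lra).
      apply Rabs_le. lra. }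
    assert (A1 := amgm (v s) d1 H1). assert (A2 := amgm (u s) d2 H2).
    apply Rabs_le_between in A1. apply Rabs_le_between in A2. apply Rabs_le.
    replace (2 * C ^ 2 / r ^ 3) with (C ^ 2 / r ^ 3 + C ^ 2 / r ^ 3) by (field; lra). lra.
Qed.

Lemma amplitude_le (r : R) : 1 <= r ->
  u (r ^ 2) ^ 2 + v (r ^ 2) ^ 2 <= 4 / 3 * (Rabs W + 2 * C ^ 2) / r.
Proof.
  intros Hr. destruct (wronskian_cross r ltac:(lra)) as [HW HX]. cbv zeta in HW, HX.
  apply Rabs_le_between in HX. set (N := u (r ^ 2) ^ 2 + v (r ^ 2) ^ 2) in *.
  assert (Hr3 : 2 * C ^ 2 / r ^ 3 <= 2 * C ^ 2).
  { apply Rle_trans with (2 * C ^ 2 / 1); [|right; field].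
    apply Rmult_le_compat_l; [generalize (pow2_ge_0 C); lra|].
    apply Rinv_le_contravar; [lra|now apply pow_R1_Rle]. }
  generalize (Rle_abs W). intros.
  apply Rmult_le_reg_r with r; [lra|].
  replace (4 / 3 * (Rabs W + 2 * C ^ 2) / r * r) with (4 / 3 * (Rabs W + 2 * C ^ 2)) by (field; lra). lra.
Qed.

(* If W <= 0 then |u|, |v| = O(1/s), so the energy u1^2 + v1^2 + s (u^2 + v^2), which is
   nondecreasing, tends to 0 and hence vanishes identically. *)
Lemma wronskian_pos : 0 < W.
Proof.
  destruct (Rlt_le_dec 0 W) as [|HW0]; [assumption|exfalso].
  set (En := fun s => u1 s ^ 2 + v1 s ^ 2 + s * (u s ^ 2 + v s ^ 2)).
  assert (DEn : forall s, is_derive En s (u s ^ 2 + v s ^ 2)).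
  { intros s. unfold En. destruct (derive_eqs s) as (E1 & E2 & E3 & E4).
    destruct (derive_exs s) as (X1 & X2 & X3 & X4).
    auto_derive; [tauto|]. rewrite E1, E2, E3, E4. ring. }
  assert (HN0 : forall s, 0 <= u s ^ 2 + v s ^ 2).
  { intros s. generalize (pow2_ge_0 (u s)) (pow2_ge_0 (v s)). lra. }
  assert (Hup : forall s, 0 < s -> En s <= 100 * C ^ 2 / s).
  { intros s Hs. set (r := sqrt s). assert (Hr : 0 < r) by now apply sqrt_lt_R0.
    assert (Es : s = r ^ 2) by (unfold r; rewrite pow2_sqrt; lra).
    destruct (wronskian_cross r Hr) as [HW HX]. cbv zeta in HW, HX. rewrite <- Es in HW, HX.
    apply Rabs_le_between in HX.
    assert (H1 := Hu1 r Hr). assert (H2 := Hv1 r Hr). rewrite <- Es in H1, H2.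
    specialize (HN0 s). set (N := u s ^ 2 + v s ^ 2) in *.
    (* The assumption [W <= 0] acts here: r N is at most the cross term, a quarter of r N is
       absorbed, and 4/3 of 2 C^2/r^3 remains. *)
    assert (HrN : r * N <= 8 / 3 * (C ^ 2 / r ^ 3)) by (unfold Rdiv in *; lra).
    assert (HN : s * N <= 8 / 3 * C ^ 2 / s).
    { replace (s * N) with (r * (r * N)) by (rewrite Es; ring).
      replace (8 / 3 * C ^ 2 / s) with (r * (8 / 3 * (C ^ 2 / r ^ 3))) by (rewrite Es; field; lra).
      apply Rmult_le_compat_l; lra. }
    assert (sq : forall x y d, Rabs d <= C / r -> x = d + y -> x ^ 2 <= 2 * (C ^ 2 / s) + 2 * y ^ 2).
    { intros x y d Hd ->. replace (C ^ 2 / s) with ((C / r) ^ 2) by (rewrite Es; field; lra).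
      assert (d ^ 2 <= (C / r) ^ 2).
      { rewrite <- (pow2_abs d). apply pow_incr. split; [apply Rabs_pos|assumption]. }
      generalize (pow2_ge_0 (d - y)). intros. nra. }
    assert (S1 := sq (u1 s) (- (r * v s)) _ H1 ltac:(ring)).
    assert (S2 := sq (v1 s) (r * u s) _ H2 ltac:(ring)).
    assert (Hy : (- (r * v s)) ^ 2 + (r * u s) ^ 2 = s * N) by (unfold N; rewrite Es at 3; ring).
    assert (0 <= C ^ 2 / s).
    { apply Rmult_le_pos; [apply pow2_ge_0|apply Rlt_le, Rinv_0_lt_compat; lra]. }
    unfold En. fold N. unfold Rdiv in *. lra. }
  assert (HE : forall s, 0 < s -> En s <= 0).
  { intros s Hs. apply nonpos_of_le_div with (100 * C ^ 2) s; [generalize (pow2_ge_0 C); lra|assumption|].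
    intros s' Hs'. apply Rle_trans with (En s'); [|apply Hup; lra].
    apply (le_of_derive_nonneg En (fun s => u s ^ 2 + v s ^ 2)); [assumption|].
    intros t _. split; [apply DEn|apply HN0]. }
  assert (Hu : forall s, 0 < s -> u s = 0).
  { intros s Hs. specialize (HE s Hs). unfold En in HE.
    generalize (pow2_ge_0 (u1 s)) (pow2_ge_0 (v1 s)) (pow2_ge_0 (v s)). intros.
    assert (s * u s ^ 2 <= 0) by (generalize (Rmult_le_pos s (v s ^ 2)); lra).
    assert (u s ^ 2 <= 0) by (apply Rmult_le_reg_l with s; lra).
    generalize (pow2_ge_0 (u s)). intros. apply Rsqr_0_uniq. unfold Rsqr. simpl in *. lra. }
  (* [u] vanishes for all s > 0; continuity at 0, tested at the point [d / 2], contradicts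
     [u 0 <> 0]. *)
  assert (Cu : continuity_pt u 0).
  { apply derivable_continuous_pt. exists (u1 0). apply is_derive_Reals, Du. }
  assert (Hpos : 0 < Rabs (u 0)) by now apply Rabs_pos_lt.
  destruct (proj1 (continuity_pt_locally u 0) Cu (mkposreal _ Hpos)) as [[d Hd] Hd1].
  specialize (Hd1 (d / 2)). simpl in Hd1. rewrite Hu in Hd1 by lra.
  assert (Hlt : Rabs (0 - u 0) < Rabs (u 0)).
  { apply Hd1. unfold ball; simpl; unfold AbsRing_ball, abs, minus, plus, opp; simpl.
    rewrite Rabs_right; lra. }
  rewrite Rminus_0_l, Rabs_Ropp in Hlt. lra.
Qed.

(** Beyond r0 = 1 + 4 C^2/W the O(r^(-3)) term is at most W/2, so (5/4) r N >= W/2. The positivity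
    of [W] is what makes this a genuine lower bound. *)
Lemma amplitude_ge : exists r0, 1 <= r0 /\ forall r, r0 <= r ->
  2 / 5 * W / r <= u (r ^ 2) ^ 2 + v (r ^ 2) ^ 2.
Proof.
  assert (HW := wronskian_pos).
  assert (P : 0 <= 4 * C ^ 2 / W).
  { apply Rmult_le_pos; [generalize (pow2_ge_0 C); lra|apply Rlt_le, Rinv_0_lt_compat; lra]. }
  exists (1 + 4 * C ^ 2 / W). split; [lra|]. intros r Hr.
  destruct (wronskian_cross r ltac:(lra)) as [HW1 HX]. cbv zeta in HW1, HX.
  apply Rabs_le_between in HX. set (N := u (r ^ 2) ^ 2 + v (r ^ 2) ^ 2) in *.
  assert (Hr3 : 2 * C ^ 2 / r ^ 3 <= W / 2).
  { apply Rmult_le_reg_r with (r ^ 3); [apply pow_lt; lra|].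
    replace (2 * C ^ 2 / r ^ 3 * r ^ 3) with (W / 2 * (4 * C ^ 2 / W)) by (field; lra).
    apply Rmult_le_compat_l; [lra|].
    assert (1 <= r ^ 2) by (apply pow_R1_Rle; lra).
    replace (r ^ 3) with (r * r ^ 2) by ring. nra. }
  apply Rmult_le_reg_r with r; [lra|].
  replace (2 / 5 * W / r * r) with (2 / 5 * W) by (field; lra). lra.
Qed.

(** The pair d1 = u1 + sqrt(s) v, d2 = v1 - sqrt(s) u rotates with speed sqrt s, but is forced by
    (v, -u)/(2 sqrt s). Adding (u, v)/(4 s) cancels exactly this forcing: p' = sqrt(s) q + p/(4 s) -
    5 u/(16 s^2) and q' = -sqrt(s) p + q/(4 s) - 5 v/(16 s^2). The diagonal terms make p^2 + q^2
    grow like sqrt s, which the weight in [Q] compensates. *)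
Let p s := u1 s + sqrt s * v s + u s / (4 * s).
Let q s := v1 s - sqrt s * u s + v s / (4 * s).
Let Q s := (p s ^ 2 + q s ^ 2) / sqrt s.

Lemma corrected_energy_derive (s : R) : 0 < s ->
  is_derive Q s (- (5 / 8) * (p s * u s + q s * v s) / (s ^ 2 * sqrt s)).
Proof.
  intros Hs. unfold Q, p, q. destruct (derive_eqs s) as (E1 & E2 & E3 & E4).
  destruct (derive_exs s) as (X1 & X2 & X3 & X4).
  assert (Hr : 0 < sqrt s) by now apply sqrt_lt_R0.
  assert (Es := sqrt_sqrt s (Rlt_le _ _ Hs)).
  auto_derive.
  - repeat split; auto; lra.
  - rewrite E1, E2, E3, E4. set (r := sqrt s) in *.
    generalize (u s) (u1 s) (v s) (v1 s). intros a a1 b b1.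
    rewrite <- Es. field. lra.
Qed.

Let C1 := 4 / 3 * (Rabs W + 2 * C ^ 2).

Lemma C1_nonneg : 0 <= C1.
Proof. unfold C1. generalize (Rabs_pos W) (pow2_ge_0 C). lra. Qed.

(** A crude a priori bound: the squares of d1, d2 are even O(r^(-2)), weakened here to match the
    amplitude term. Its purpose is to show that [Q] tends to 0 and to bound the derivative of
    [Q]. *)
Lemma corrected_norm_le (r : R) : 1 <= r ->
  p (r ^ 2) ^ 2 + q (r ^ 2) ^ 2 <= (4 * C ^ 2 + C1) / r.
Proof.
  intros Hr. unfold p, q. rewrite sqrt_pow2 by lra.
  assert (HN := amplitude_le r Hr). fold C1 in HN.
  assert (H1 := Hu1 r ltac:(lra)). assert (H2 := Hv1 r ltac:(lra)).
  set (s := r ^ 2) in *. assert (Hs : 1 <= s) by now apply pow_R1_Rle.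
  set (d1 := u1 s + r * v s) in *. set (d2 := v1 s - r * u s) in *.
  assert (His : 0 < / s <= 1) by (split; [apply Rinv_0_lt_compat; lra|rewrite <- Rinv_1; apply Rinv_le_contravar; lra]).
  assert (sq : forall d y, Rabs d <= C / r -> (d + y / (4 * s)) ^ 2 <= 2 * (C ^ 2 / r) + y ^ 2).
  { intros d y Hd.
    assert (Hd2 : d ^ 2 <= C ^ 2 / r).
    { apply Rle_trans with ((C / r) ^ 2).
      - rewrite <- (pow2_abs d). apply pow_incr. split; [apply Rabs_pos|assumption].
      - replace ((C / r) ^ 2) with (C ^ 2 / r * / r) by (field; lra).
        assert (/ r <= 1) by (rewrite <- Rinv_1; apply Rinv_le_contravar; lra).
        rewrite <- (Rmult_1_r (C ^ 2 / r)) at 2. apply Rmult_le_compat_l; [|assumption].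
        apply Rmult_le_pos; [apply pow2_ge_0|apply Rlt_le, Rinv_0_lt_compat; lra]. }
    assert (Hy2 : (y / (4 * s)) ^ 2 <= y ^ 2 / 2).
    { replace ((y / (4 * s)) ^ 2) with (y ^ 2 / 16 * (/ s * / s)) by (field; lra).
      assert (/ s * / s <= 1) by nra. generalize (pow2_ge_0 y). nra. }
    generalize (pow2_ge_0 (d - y / (4 * s))). nra. }
  assert (S1 := sq d1 (u s) H1). assert (S2 := sq d2 (v s) H2).
  replace ((4 * C ^ 2 + C1) / r) with (4 * (C ^ 2 / r) + C1 / r) by (field; lra). lra.
Qed.

(* (d1, d2) + (u, v) / (4 s) solves a rotation system up to an O(s^-2 (u, v)) forcing, so its
   weighted norm Q is almost constant; it tends to 0, which improves its a priori size. *)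
Lemma corrected_energy_le (s : R) : 1 <= s -> Q s <= (2 * C ^ 2 + C1) / s ^ 2.
Proof.
  (* [C2] comes from |p u + q v| <= ((p^2 + q^2) + (u^2 + v^2))/2 with the two bounds (4 C^2 + C1)/r
     and C1/r. *)
  intros Hs1. set (C2 := 2 * C ^ 2 + C1).
  assert (HC1 := C1_nonneg). assert (HC := pow2_ge_0 C).
  assert (HQ : forall s, 1 <= s -> Q s <= (4 * C ^ 2 + C1) / s /\ Rabs (p s * u s + q s * v s) <= C2 / sqrt s).
  { clear s Hs1. intros s Hs. set (r := sqrt s).
    assert (Hr : 1 <= r) by (unfold r; rewrite <- sqrt_1; now apply sqrt_le_1_alt).
    assert (Es : s = r ^ 2) by (unfold r; rewrite pow2_sqrt; lra).
    assert (Hpq := corrected_norm_le r Hr). assert (HN := amplitude_le r Hr). fold C1 in HN.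
    rewrite <- Es in Hpq, HN. split.
    - unfold Q. fold r. replace ((4 * C ^ 2 + C1) / s) with ((4 * C ^ 2 + C1) / r / r) by (rewrite Es; field; lra).
      apply Rmult_le_compat_r; [apply Rlt_le, Rinv_0_lt_compat; lra|assumption].
    - replace (C2 / r) with (((4 * C ^ 2 + C1) / r + C1 / r) / 2) by (unfold C2; field; lra).
      generalize (pow2_ge_0 (p s - u s)) (pow2_ge_0 (q s - v s)) (pow2_ge_0 (p s + u s)) (pow2_ge_0 (q s + v s)).
      intros. apply Rabs_le. split; nra. }
  (* [H] is nondecreasing, since Q' >= -(5/8) C2/s^3 while C2/s^2 has derivative -2 C2/s^3. It is
     bounded above by [Q], which tends to 0, hence H <= 0 throughout. *)
  set (H := fun s => Q s - C2 / s ^ 2).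
  assert (HH : H s <= 0).
  { apply nonpos_of_le_div with (4 * C ^ 2 + C1) s; [lra|lra|]. intros s' Hs'.
    apply Rle_trans with (H s').
    - apply (le_of_derive_nonneg H (fun s => - (5 / 8) * (p s * u s + q s * v s) / (s ^ 2 * sqrt s) + 2 * C2 / s ^ 3)); [assumption|].
      intros t Ht. split.
      + replace (- (5 / 8) * (p t * u t + q t * v t) / (t ^ 2 * sqrt t) + 2 * C2 / t ^ 3)
          with (minus (- (5 / 8) * (p t * u t + q t * v t) / (t ^ 2 * sqrt t)) (- (2 * C2 / t ^ 3)))
          by (unfold minus, plus, opp; simpl; ring).
        apply (is_derive_minus Q (fun s => C2 / s ^ 2)); [apply corrected_energy_derive; lra|].
        auto_derive; [assert (0 < t * t) by nra; simpl in *; lra|]. field. lra.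
      + destruct (HQ t ltac:(lra)) as [_ Hb]. apply Rabs_le_between in Hb.
        assert (Hr : 0 < sqrt t) by (apply sqrt_lt_R0; lra).
        assert (Et := sqrt_sqrt t ltac:(lra)).
        set (r := sqrt t) in *. set (z := p t * u t + q t * v t) in *.
        assert (Ht2 : 0 < t ^ 2 * r) by (apply Rmult_lt_0_compat; [apply pow_lt|]; lra).
        replace (2 * C2 / t ^ 3) with (2 * (C2 / r) / (t ^ 2 * r)) by (rewrite <- Et; field; lra).
        replace (- (5 / 8) * z / (t ^ 2 * r) + 2 * (C2 / r) / (t ^ 2 * r))
          with ((2 * (C2 / r) - 5 / 8 * z) / (t ^ 2 * r)) by (field; lra).
        apply Rmult_le_pos; [|apply Rlt_le, Rinv_0_lt_compat; lra].
        assert (0 <= C2 / r) by (apply Rmult_le_pos; [unfold C2; lra|apply Rlt_le, Rinv_0_lt_compat; lra]).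
        lra.
    - destruct (HQ s' ltac:(lra)) as [Hb _]. unfold H.
      assert (0 <= C2 / s' ^ 2) by (apply Rmult_le_pos; [unfold C2; lra|apply Rlt_le, Rinv_0_lt_compat, pow_lt; lra]).
      lra. }
  unfold H in HH. lra.
Qed.

(** The quotient is the derivative of the argument of u + i v and equals W/N with N = u^2 + v^2. Its
    distance to r = sqrt s is X/N with X = u d2 - v d1, so X^2 <= N (d1^2 + d2^2), d1^2 + d2^2 =
    O(r^(-3)) and N >= const/r together give O(1/r). *)
Theorem airy_phase_velocity : exists S0 K, 1 <= S0 /\ 0 <= K /\ forall s, S0 <= s ->
  0 < u s ^ 2 + v s ^ 2 /\
  Rabs ((u s * v1 s - v s * u1 s) / (u s ^ 2 + v s ^ 2) - sqrt s) <= K / sqrt s.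
Proof.
  destruct amplitude_ge as (r0 & Hr0 & Hlow). assert (HW := wronskian_pos).
  assert (HC1 := C1_nonneg). assert (HC := pow2_ge_0 C).
  (* d1^2 + d2^2 is at most twice p^2 + q^2 = r Q plus twice the squared correction (u, v)/(4 s);
     [K2] then divides by the lower bound (2/5) W/r of the amplitude. *)
  set (C5 := 2 * (2 * C ^ 2 + C1) + C1).
  set (K2 := C5 * (5 / (2 * W))).
  assert (HK2 : 0 <= K2).
  { apply Rmult_le_pos; [unfold C5; lra|]. apply Rlt_le, Rdiv_lt_0_compat; lra. }
  exists (r0 ^ 2), (sqrt K2). split; [now apply pow_R1_Rle|]. split; [apply sqrt_pos|].
  intros s Hs. set (r := sqrt s).
  assert (Hr02 : 1 <= r0 ^ 2) by now apply pow_R1_Rle.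
  assert (Es : s = r ^ 2) by (unfold r; rewrite pow2_sqrt; lra).
  assert (Hr : r0 <= r).
  { unfold r. rewrite <- (sqrt_pow2 r0) by lra. now apply sqrt_le_1_alt. }
  assert (HN := Hlow r Hr). assert (HNu := amplitude_le r ltac:(lra)). fold C1 in HNu.
  assert (HQ := corrected_energy_le s ltac:(lra)).
  destruct (wronskian_cross r ltac:(lra)) as [HWe _]. cbv zeta in HWe.
  rewrite <- Es in HN, HNu, HWe.
  assert (Hlow0 : 0 < 2 / 5 * W / r) by (apply Rdiv_lt_0_compat; lra).
  split; [lra|].
  rewrite wronskian_const by lra.
  set (N := u s ^ 2 + v s ^ 2) in *.
  set (d1 := u1 s + r * v s) in *. set (d2 := v1 s - r * u s) in *.
  set (X := u s * d2 - v s * d1) in *.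
  assert (Hd : d1 ^ 2 + d2 ^ 2 <= C5 / r ^ 3).
  { unfold Q, p, q in HQ. fold r in HQ. fold d1 d2 in HQ.
    assert (HQ' : (d1 + u s / (4 * s)) ^ 2 + (d2 + v s / (4 * s)) ^ 2 <= (2 * C ^ 2 + C1) / r ^ 3).
    { apply Rmult_le_reg_r with (/ r); [apply Rinv_0_lt_compat; lra|].
      replace ((2 * C ^ 2 + C1) / r ^ 3 * / r) with ((2 * C ^ 2 + C1) / s ^ 2) by (rewrite Es; field; lra).
      exact HQ. }
    assert (Hw : (u s / (4 * s)) ^ 2 + (v s / (4 * s)) ^ 2 <= C1 / r ^ 3 / 2).
    { replace ((u s / (4 * s)) ^ 2 + (v s / (4 * s)) ^ 2) with (N * / (16 * s ^ 2))
        by (unfold N; field; lra).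
      replace (s ^ 2) with (r ^ 4) by (rewrite Es; ring).
      apply Rle_trans with (C1 / r * / (16 * r ^ 4)).
      - apply Rmult_le_compat_r; [|lra]. apply Rlt_le, Rinv_0_lt_compat, Rmult_lt_0_compat; [lra|apply pow_lt; lra].
      - replace (C1 / r * / (16 * r ^ 4)) with (C1 / r ^ 3 / 2 * (/ (8 * r ^ 2))) by (field; lra).
        rewrite <- (Rmult_1_r (C1 / r ^ 3 / 2)) at 2. apply Rmult_le_compat_l.
        + assert (0 <= C1 / r ^ 3) by (apply Rmult_le_pos; [lra|apply Rlt_le, Rinv_0_lt_compat, pow_lt; lra]). lra.
        + rewrite <- Rinv_1. apply Rinv_le_contravar; [lra|]. assert (1 <= r ^ 2) by (apply pow_R1_Rle; lra). lra. }
    replace (C5 / r ^ 3) with (2 * ((2 * C ^ 2 + C1) / r ^ 3) + 2 * (C1 / r ^ 3 / 2)) by (unfold C5; field; lra).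
    generalize (pow2_ge_0 (d1 + 2 * (u s / (4 * s)))) (pow2_ge_0 (d2 + 2 * (v s / (4 * s)))).
    intros. nra. }
  (* Lagrange's identity: the difference of the two sides is (u d1 + v d2)^2. *)
  assert (HX : X ^ 2 <= N * (d1 ^ 2 + d2 ^ 2)).
  { unfold X, N. generalize (pow2_ge_0 (u s * d1 + v s * d2)). nra. }
  replace (W / N - r) with (X / N) by (rewrite HWe; field; lra).
  rewrite <- sqrt_pow2 with (x := r) by lra.
  rewrite <- sqrt_div_alt by (apply pow_lt; lra).
  rewrite <- (sqrt_Rsqr_abs (X / N)). apply sqrt_le_1_alt. unfold Rsqr.
  apply Rmult_le_reg_r with (N ^ 2); [apply pow_lt; lra|].
  replace (X / N * (X / N) * N ^ 2) with (X ^ 2) by (field; lra).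
  eapply Rle_trans; [apply HX|].
  replace (K2 / r ^ 2 * N ^ 2) with (N * (K2 / r ^ 2 * N)) by ring.
  apply Rmult_le_compat_l; [lra|].
  eapply Rle_trans; [apply Hd|].
  replace (C5 / r ^ 3) with (K2 / r ^ 2 * (2 / 5 * W / r)) by (unfold K2; field; lra).
  apply Rmult_le_compat_l; [|assumption].
  apply Rmult_le_pos; [assumption|]. apply Rlt_le, Rinv_0_lt_compat, pow_lt; lra.
Qed.

End AirySystem.

(** * The phase of the reference solution *)

(* Near x the phase equals f x + atan (cross / dot) of the vectors (X, Y) at x and y. *)
Lemma phase_derive (X Y f r : R -> R) (x X' Y' : R) :
  continuous f x -> is_derive X x X' -> is_derive Y x Y' ->
  (forall y, 0 <= r y /\ X y = r y * cos (f y) /\ Y y = r y * sin (f y)) ->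
  0 < X x ^ 2 + Y x ^ 2 ->
  is_derive f x ((X x * Y' - Y x * X') / (X x ^ 2 + Y x ^ 2)).
Proof.
  intros Cf DX DY Hr HN.
  set (dot := fun y => X x * X y + Y x * Y y).
  set (cross := fun y => X x * Y y - Y x * X y).
  assert (Hdot0 : dot x = X x ^ 2 + Y x ^ 2) by (unfold dot; ring).
  assert (Ddot : is_derive dot x (X x * X' + Y x * Y')).
  { unfold dot. auto_derive; [split; [now exists X'|split; [now exists Y'|auto]]|].
    replace (Derive (fun y => X y) x) with X' by (symmetry; now apply is_derive_unique).
    replace (Derive (fun y => Y y) x) with Y' by (symmetry; now apply is_derive_unique). ring. }
  assert (Dcross : is_derive cross x (X x * Y' - Y x * X')).
  { unfold cross. auto_derive; [split; [now exists Y'|split; [now exists X'|auto]]|].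
    replace (Derive (fun y => X y) x) with X' by (symmetry; now apply is_derive_unique).
    replace (Derive (fun y => Y y) x) with Y' by (symmetry; now apply is_derive_unique). ring. }
  assert (Cdot : continuity_pt dot x).
  { apply derivable_continuous_pt. eexists. apply is_derive_Reals, Ddot. }
  assert (Cf' : continuity_pt f x) by now apply continuity_pt_filterlim.
  (* The radius [dot x] keeps [dot y] positive, and the radius PI/2 keeps f y - f x on the branch
     where [atan] inverts [tan]. *)
  assert (L1 := proj1 (continuity_pt_locally dot x) Cdot (mkposreal _ HN)).
  assert (L2 := proj1 (continuity_pt_locally f x) Cf' (mkposreal _ PI2_RGT_0)).
  apply is_derive_ext_loc with (fun y => f x + atan (cross y / dot y)).
  - generalize (filter_and _ _ L1 L2). apply filter_imp. intros y [H1 H2]. simpl in H1, H2.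
    apply Rabs_def2 in H1. apply Rabs_def2 in H2.
    destruct (Hr x) as (Rx & EXx & EYx). destruct (Hr y) as (Ry & EXy & EYy).
    assert (Hd : dot y = r x * r y * cos (f y - f x)).
    { unfold dot. rewrite EXx, EYx, EXy, EYy, cos_minus. ring. }
    assert (Hc : cross y = r x * r y * sin (f y - f x)).
    { unfold cross. rewrite EXx, EYx, EXy, EYy, sin_minus. ring. }
    assert (Hdp : 0 < dot y) by (rewrite Hdot0 in H1; simpl in *; lra).
    assert (Hcos : cos (f y - f x) <> 0) by (intros E; rewrite E in Hd; lra).
    assert (Hrr : r x * r y <> 0) by (intros E; rewrite E in Hd; lra).
    replace (cross y / dot y) with (tan (f y - f x)).
    + rewrite atan_tan by lra. change (f x + (f y - f x) = f y :> R). ring.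
    + rewrite Hc, Hd. unfold tan. field. now repeat split; try assumption; intros E; rewrite E in Hrr; lra.
  - assert (Hcr : cross x = 0) by (unfold cross; ring).
    auto_derive.
    + split; [eexists; apply Dcross|]. split; [eexists; apply Ddot|]. split; [rewrite Hdot0; lra|auto].
    + replace (Derive (fun y => cross y) x) with (X x * Y' - Y x * X') by (symmetry; now apply is_derive_unique).
      rewrite Hcr, Hdot0. field. lra.
Qed.

(** This absorbs the shift E/F: its effect on the square root is of the order of the admissible
    error 1/sqrt x. *)
Lemma sqrt_shift_le (x e : R) : 0 < x -> 0 <= x + e -> Rabs (sqrt (x + e) - sqrt x) <= Rabs e / sqrt x.
Proof.
  intros Hx Hxe. assert (Hp : 0 < sqrt x) by now apply sqrt_lt_R0.
  assert (Hq := sqrt_pos (x + e)).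
  assert (E0 := sqrt_sqrt x ltac:(lra)). assert (E1 := sqrt_sqrt (x + e) Hxe).
  apply Rmult_le_reg_r with (sqrt x); [lra|].
  replace (Rabs e / sqrt x * sqrt x) with (Rabs e) by (field; lra).
  replace e with ((sqrt (x + e) - sqrt x) * (sqrt (x + e) + sqrt x)) at 2 by nra.
  rewrite Rabs_mult, (Rabs_right (sqrt (x + e) + sqrt x)) by lra.
  apply Rmult_le_compat_l; [apply Rabs_pos|lra].
Qed.

(** [zeta] is a positive multiple of u + i v at F^(1/3) (x + E/F), so it has the same phase; the
    velocity is that of the Airy system times F^(1/3). The conclusion includes differentiability, so
    that [Derive gamma] is a true derivative for large x. *)
Theorem phase_asymptotics (F E : R) (gamma : R -> R) : 0 < F -> is_phase F E gamma ->
  exists X0 C, 0 < X0 /\ 0 <= C /\ forall x, X0 <= x ->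
    is_derive gamma x (Derive gamma x) /\ Rabs (Derive gamma x - sqrt F * sqrt x) <= C / sqrt x.
Proof.
  intros HF (Cg & Hg & _).
  destruct airy_solution_pair as (a & a1 & b & b1 & HAB & Da & Db & HD & Hb0).
  set (u := fun s => b (- s)). set (u1 := fun s => - b1 (- s)).
  set (v := fun s => a (- s)). set (v1 := fun s => - a1 (- s)).
  assert (comp : forall (f : R -> R) s l, is_derive f (- s) l -> is_derive (fun s => f (- s)) s (- l)).
  { intros f s l Hf. replace (- l) with (scal (-1) l) by (unfold scal; simpl; unfold mult; simpl; ring).
    apply (is_derive_comp f (fun s => - s)); [assumption|]. auto_derive; auto. }
  assert (Du : forall s, is_derive u s (u1 s)) by (intros; apply comp, Db).
  assert (Dv : forall s, is_derive v s (v1 s)) by (intros; apply comp, Da).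
  assert (Du1 : forall s, is_derive u1 s (- s * u s)).
  { intros s. replace (- s * u s) with (- - (- s * b (- s))) by (unfold u; ring).
    apply (is_derive_opp (fun s => b1 (- s))). apply comp, Db. }
  assert (Dv1 : forall s, is_derive v1 s (- s * v s)).
  { intros s. replace (- s * v s) with (- - (- s * a (- s))) by (unfold v; ring).
    apply (is_derive_opp (fun s => a1 (- s))). apply comp, Da. }
  destruct (airy_phase_velocity u u1 v v1 3) as (S0 & K & HS0 & HK & Hvel); try assumption.
  - intros r Hr. unfold u1, v. destruct (HD r Hr) as [H1 _].
    replace (- b1 (- r ^ 2) + r * a (- r ^ 2)) with (- (b1 (- r ^ 2) - r * a (- r ^ 2))) by ring.
    now rewrite Rabs_Ropp.
  - intros r Hr. unfold v1, u. destruct (HD r Hr) as [_ H1].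
    replace (- a1 (- r ^ 2) - r * b (- r ^ 2)) with (- (a1 (- r ^ 2) + r * b (- r ^ 2))) by ring.
    now rewrite Rabs_Ropp.
  - unfold u. rewrite Ropp_0. lra.
  - set (k := Rpower F (1 / 3)). assert (Hk : 0 < k) by apply exp_pos.
    set (e := E / F).
    (* The normalisation of [zeta] together with the 1/PI by which Ai and Bi differ from [a] and
       [b]. *)
    set (c := sqrt (PI / k) / PI).
    assert (HPI := PI_RGT_0).
    assert (Hc : 0 < c) by (apply Rdiv_lt_0_compat; [apply sqrt_lt_R0, Rdiv_lt_0_compat|]; lra).
    set (sx := fun x => k * (x + e)).
    assert (Hre : forall x, zeta_re F E x = c * u (sx x)).
    { intros x. unfold zeta_re, airy_arg. fold k. destruct (HAB (- k * (x + E / F))) as [_ ->].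
      unfold c, u, sx. replace (- (k * (x + e))) with (- k * (x + E / F)) by (unfold e; ring). field; lra. }
    assert (Him : forall x, zeta_im F E x = c * v (sx x)).
    { intros x. unfold zeta_im, airy_arg. fold k. destruct (HAB (- k * (x + E / F))) as [-> _].
      unfold c, v, sx. replace (- (k * (x + e))) with (- k * (x + E / F)) by (unfold e; ring). field; lra. }
    assert (Dcs : forall (f : R -> R) x l, is_derive f (sx x) l -> is_derive (fun x => c * f (sx x)) x (c * (k * l))).
    { intros f x l Hf. apply (is_derive_scal (fun x => f (sx x)) x c (k * l)).
      apply (is_derive_comp f sx x l k); [assumption|]. unfold sx. auto_derive; auto. ring. }
    assert (Hder : forall x, S0 <= sx x ->
      is_derive gamma x (k * ((u (sx x) * v1 (sx x) - v (sx x) * u1 (sx x)) / (u (sx x) ^ 2 + v (sx x) ^ 2)))).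
    { intros x Hx. destruct (Hvel _ Hx) as [HN _].
      assert (HcN : 0 < (c * u (sx x)) ^ 2 + (c * v (sx x)) ^ 2).
      { replace ((c * u (sx x)) ^ 2 + (c * v (sx x)) ^ 2) with (c ^ 2 * (u (sx x) ^ 2 + v (sx x) ^ 2)) by ring.
        apply Rmult_lt_0_compat; [apply pow_lt; lra|assumption]. }
      assert (Hp := phase_derive (fun x => c * u (sx x)) (fun x => c * v (sx x)) gamma (zeta_abs F E) x
        _ _ (Cg x) (Dcs u x _ (Du _)) (Dcs v x _ (Dv _))).
      replace (k * ((u (sx x) * v1 (sx x) - v (sx x) * u1 (sx x)) / (u (sx x) ^ 2 + v (sx x) ^ 2)))
        with ((c * u (sx x) * (c * (k * v1 (sx x))) - c * v (sx x) * (c * (k * u1 (sx x))))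
          / ((c * u (sx x)) ^ 2 + (c * v (sx x)) ^ 2)) by (field; split; lra).
      apply Hp; [|assumption].
      intros y. destruct (Hg y) as [G1 G2]. split; [apply sqrt_pos|].
      now rewrite <- Hre, <- Him. }
    (* The term 2 |e| gives x + e >= x/2, and 2 S0/k then gives [sx x >= S0]. *)
    set (X0 := 1 + 2 * Rabs e + 2 * S0 / k).
    assert (He0 := Rabs_pos e).
    assert (HSk : 0 < 2 * S0 / k) by (apply Rdiv_lt_0_compat; lra).
    (* As k = F^(1/3), k^(3/2) = F^(1/2): this turns k sqrt(k (x + e)) into sqrt F sqrt(x + e). *)
    assert (Hkk : k * sqrt k = sqrt F).
    { rewrite <- (Rpower_sqrt k), <- (Rpower_sqrt F) by assumption. unfold k.
      rewrite Rpower_mult, <- Rpower_plus. f_equal. field. }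
    exists X0, (k * K * sqrt (2 / k) + sqrt F * Rabs e).
    split; [unfold X0; lra|]. split.
    { apply Rplus_le_le_0_compat; repeat apply Rmult_le_pos; try lra; apply sqrt_pos. }
    intros x Hx. unfold X0 in Hx.
    assert (Hxe : x / 2 <= x + e) by (generalize (Rle_abs (- e)); rewrite Rabs_Ropp; lra).
    assert (Hsx2 : k / 2 * x <= sx x).
    { unfold sx. replace (k / 2 * x) with (k * (x / 2)) by field. apply Rmult_le_compat_l; lra. }
    assert (HsS : S0 <= sx x).
    { eapply Rle_trans; [|apply Hsx2]. apply Rle_trans with (k / 2 * (2 * S0 / k)); [right; field; lra|].
      apply Rmult_le_compat_l; lra. }
    assert (Hd := Hder x HsS). rewrite (is_derive_unique _ _ _ Hd). split; [assumption|].
    destruct (Hvel _ HsS) as [_ Hv].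
    set (z := (u (sx x) * v1 (sx x) - v (sx x) * u1 (sx x)) / (u (sx x) ^ 2 + v (sx x) ^ 2)) in *.
    assert (Hsq : k * sqrt (sx x) = sqrt F * sqrt (x + e)).
    { unfold sx. rewrite sqrt_mult_alt by lra. rewrite <- Hkk. ring. }
    replace (k * z - sqrt F * sqrt x) with (k * (z - sqrt (sx x)) + sqrt F * (sqrt (x + e) - sqrt x))
      by (rewrite Rmult_minus_distr_l, Hsq; ring).
    eapply Rle_trans; [apply Rabs_triang|].
    rewrite !Rabs_mult, (Rabs_right k), (Rabs_right (sqrt F)) by (try apply Rle_ge, sqrt_pos; lra).
    assert (Hsh := sqrt_shift_le x e ltac:(lra) ltac:(lra)).
    assert (Hpx : 0 < sqrt x) by (apply sqrt_lt_R0; lra).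
    replace ((k * K * sqrt (2 / k) + sqrt F * Rabs e) / sqrt x)
      with (k * (K * (sqrt (2 / k) / sqrt x)) + sqrt F * (Rabs e / sqrt x)) by (field; lra).
    apply Rplus_le_compat.
    + apply Rmult_le_compat_l; [lra|]. eapply Rle_trans; [apply Hv|].
      apply Rmult_le_compat_l; [assumption|].
      rewrite <- sqrt_div_alt by lra. rewrite <- sqrt_inv. apply sqrt_le_1_alt.
      replace (2 / k / x) with (/ (k / 2 * x)) by (field; lra).
      apply Rinv_le_contravar; [|assumption]. apply Rmult_lt_0_compat; lra.
    + apply Rmult_le_compat_l; [apply sqrt_pos|assumption].
Qed.

(** Squaring makes the error bounded: an error C/sqrt x against sqrt(F x) gives g^2 = F x + O(1),
    hence 1/g^2 = 1/(F x) + O(x^(-2)). *)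
Lemma inv_sqr_asymptotics (g : nat -> R) (F C X0 : R) : 0 < F -> 0 <= C ->
  (forall j, X0 <= INR j -> Rabs (g j - sqrt F * sqrt (INR j)) <= C / sqrt (INR j)) ->
  forall eps, 0 < eps -> exists A, forall j, (A <= j)%nat ->
    Rabs (/ g j ^ 2 - / F / INR j) <= eps / INR j.
Proof.
  intros HF HC Hg eps He.
  set (k := sqrt F). assert (Hk : 0 < k) by now apply sqrt_lt_R0.
  assert (Ek : k * k = F) by (apply sqrt_sqrt; lra).
  set (C' := 2 * k * C + C ^ 2).
  assert (HC' : 0 <= C').
  { unfold C'. apply Rplus_le_le_0_compat; [repeat apply Rmult_le_pos; lra|apply pow2_ge_0]. }
  (* The term 2 C'/F gives g^2 >= F x/2, and the last one brings the resulting error 2 C'/(F x)^2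
     below eps/x. *)
  set (T := 1 + Rabs X0 + 2 * C' / F + 2 * C' / F ^ 2 / eps).
  assert (T1 : 0 <= 2 * C' / F) by (apply Rmult_le_pos; [lra|apply Rlt_le, Rinv_0_lt_compat; lra]).
  assert (T2 : 0 <= 2 * C' / F ^ 2 / eps).
  { repeat apply Rmult_le_pos; try lra; apply Rlt_le, Rinv_0_lt_compat; [apply pow_lt|]; lra. }
  assert (T0 := Rabs_pos X0).
  destruct (nfloor_ex T) as [A [_ HA]]; [unfold T; lra|].
  exists (S A). intros j Hj.
  assert (HjT : T < INR j).
  { eapply Rlt_le_trans; [apply HA|]. rewrite <- S_INR. now apply le_INR. }
  specialize (Hg j ltac:(unfold T in HjT; generalize (Rle_abs X0); lra)). fold k in Hg.
  set (x := INR j) in *. set (y := g j) in *. unfold T in HjT.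
  assert (Hr : 0 < sqrt x) by (apply sqrt_lt_R0; lra). assert (Er := sqrt_sqrt x ltac:(lra)).
  set (r := sqrt x) in *.
  assert (Hr1 : 1 <= r) by nra.
  assert (Hsq : Rabs (y ^ 2 - F * x) <= C').
  { set (d := y - k * r) in *.
    replace (y ^ 2 - F * x) with (2 * k * (r * d) + d ^ 2) by (unfold d; rewrite <- Ek, <- Er; ring).
    assert (Hrd : Rabs (r * d) <= C).
    { rewrite Rabs_mult, (Rabs_right r) by lra.
      apply Rle_trans with (r * (C / r)); [apply Rmult_le_compat_l; lra|right; field; lra]. }
    assert (Hd : Rabs d <= C).
    { eapply Rle_trans; [apply Hg|]. apply Rmult_le_reg_r with r; [lra|].
      replace (C / r * r) with C by (field; lra). nra. }
    eapply Rle_trans; [apply Rabs_triang|]. unfold C'. apply Rplus_le_compat.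
    - rewrite Rabs_mult, (Rabs_right (2 * k)) by lra. apply Rmult_le_compat_l; lra.
    - rewrite <- RPow_abs. apply pow_incr. split; [apply Rabs_pos|assumption]. }
  assert (Hlow : F * x / 2 <= y ^ 2).
  { apply Rabs_le_between in Hsq.
    assert (C' <= F * x / 2); [|lra].
    apply Rle_trans with (F / 2 * (2 * C' / F)); [right; field; lra|].
    replace (F * x / 2) with (F / 2 * x) by field. apply Rmult_le_compat_l; lra. }
  assert (HFx : 0 < F * x) by (apply Rmult_lt_0_compat; lra).
  assert (Hy : y <> 0) by (intros E; rewrite E in Hlow; simpl in Hlow; lra).
  replace (/ y ^ 2 - / F / x) with (- (y ^ 2 - F * x) * / (y ^ 2 * (F * x))) by (field; repeat split; lra).
  rewrite Rabs_mult, Rabs_Ropp, Rabs_inv, (Rabs_right (y ^ 2 * (F * x))).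
  2:{ apply Rle_ge, Rmult_le_pos; lra. }
  apply Rle_trans with (C' * / (F * x / 2 * (F * x))).
  - apply Rmult_le_compat; [apply Rabs_pos|apply Rlt_le, Rinv_0_lt_compat, Rmult_lt_0_compat; lra|assumption|].
    apply Rinv_le_contravar; [apply Rmult_lt_0_compat; lra|]. apply Rmult_le_compat_r; lra.
  - replace (C' * / (F * x / 2 * (F * x))) with (2 * C' / F ^ 2 / x / x) by (field; lra).
    apply Rmult_le_compat_r; [apply Rlt_le, Rinv_0_lt_compat; lra|].
    apply Rmult_le_reg_r with x; [lra|].
    replace (2 * C' / F ^ 2 / x * x) with (eps * (2 * C' / F ^ 2 / eps)) by (field; lra).
    apply Rmult_le_compat_l; lra.
Qed.

Theorem S_re_log_small (mu F E : R) (gamma : R -> R) (h : nat -> R) :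
  0 < mu -> 0 < F -> is_phase F E gamma ->
  is_lim_seq (fun j => Rabs (h (S j) - h j) * Rpower (INR j) (1/4)) 0 ->
  is_lim_seq (fun N => S_re mu gamma h N / ln (INR N)) 0.
Proof.
  intros Hmu HF Hph Hh.
  destruct (phase_asymptotics F E gamma HF Hph) as (X0 & C & HX0 & HC & Has).
  apply (weighted_log_sum (fun j => cos (mu * gamma (INR j) + h j)) (fun j => / Derive gamma (INR j) ^ 2) (/ F)).
  - intros j. apply Rabs_le, COS_bound.
  - apply (small_block_means mu (sqrt F) C X0 gamma (Derive gamma) h); try assumption.
    now apply sqrt_lt_R0.
  - apply (inv_sqr_asymptotics (fun j => Derive gamma (INR j)) F C X0); try assumption.
    intros j Hj. now apply Has.
Qed.

Theorem theorem4p3 (mu F E : R) (gamma : R -> R) (h : nat -> R) :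
  0 < mu -> 0 < F ->
  is_phase F E gamma ->
  is_lim_seq (fun j => Rabs (h (S j) - h j) * Rpower (INR j) (1/4)) 0 ->
  is_lim_seq (fun N => sqrt (S_re mu gamma h N ^ 2 + S_im mu gamma h N ^ 2) / ln (INR N)) 0.
Proof.
  intros Hmu HF Hph Hh.
  assert (HR := S_re_log_small mu F E gamma h Hmu HF Hph Hh).
  assert (HI : is_lim_seq (fun N => S_im mu gamma h N / ln (INR N)) 0).
  (* The sine is the cosine with phase shifted by -PI/2; moving this constant into [h] leaves the
     increments of [h] unchanged, so the cosine case applies. *)
  { apply is_lim_seq_ext with (fun N => S_re mu gamma (fun j => h j + - (PI / 2)) N / ln (INR N)).
    - intros N. f_equal. apply sum_n_m_ext. intros j. f_equal.
      rewrite <- Rplus_assoc. apply cos_minus_PI2.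
    - apply (S_re_log_small mu F E); try assumption.
      apply is_lim_seq_ext with (2 := Hh). intros j. do 2 f_equal. ring. }
  apply (is_lim_seq_abs _ 0) in HR. apply (is_lim_seq_abs _ 0) in HI. simpl in HR, HI.
  rewrite Rabs_R0 in HR, HI.
  apply is_lim_seq_le_le_loc with (fun _ => 0)
    (fun N => Rabs (S_re mu gamma h N / ln (INR N)) + Rabs (S_im mu gamma h N / ln (INR N))).
  - exists 3%nat. intros N HN.
    assert (Hl : 0 < ln (INR N)).
    { rewrite <- ln_1. apply ln_increasing; [lra|]. apply (lt_INR 1). lia. }
    set (x := S_re mu gamma h N). set (y := S_im mu gamma h N).
    split; [apply Rmult_le_pos; [apply sqrt_pos|apply Rlt_le, Rinv_0_lt_compat; lra]|].
    unfold Rdiv. rewrite !Rabs_mult, Rabs_inv, (Rabs_right (ln (INR N))) by lra.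
    rewrite <- Rmult_plus_distr_r. apply Rmult_le_compat_r; [apply Rlt_le, Rinv_0_lt_compat; lra|].
    assert (0 <= Rabs x) by apply Rabs_pos. assert (0 <= Rabs y) by apply Rabs_pos.
    rewrite <- (sqrt_pow2 (Rabs x + Rabs y)) by lra. apply sqrt_le_1_alt.
    rewrite <- (pow2_abs x), <- (pow2_abs y). nra.
  - apply is_lim_seq_const.
  - replace (Finite 0) with (Finite (0 + 0)) by (f_equal; ring).
    now apply (is_lim_seq_plus' _ _ 0 0).
Qed.
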